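(* For a solid partition $\pi$, let $\omega_\pi$ be the rational number determined by $$L_\pi(0,0,0,-d)\,\mathsf{w}_\pi\big|_{\lambda_1+\lambda_2+\lambda_3=0}=(-1)^{|\pi|}\,\omega_\pi\prod_{l=1}^{\pi_{111}}(d-(l-1)) \qquad (\ast)$$ (in the cases below, the specialization and such a number, independent of $d,\lambda_1,\lambda_2,\lambda_3$, exist), and let $\omega^c_\pi$ be the combinatorial weight defined in the context. Then: (1) $\omega_\pi=\omega^c_\pi$ for every solid partition $\pi$ of size $|\pi|\leqslant6$, where the signs of $(\mathsf{w}_\pi)_{|\pi|\leqslant6}$ are the unique ones for which $$\sum_{\pi} L_\pi(d_1,d_2,d_3,d_4)\,\mathsf{w}_\pi\,q^{|\pi|}\equiv M(-q)^{\frac{(d_1\lambda_1+d_2\lambda_2+d_3\lambda_3+d_4\lambda_4)(-\lambda_1\lambda_2\lambda_3-\lambda_1\lambda_2\lambda_4-\lambda_1\lambda_3\lambda_4-\lambda_2\lambda_3\lambda_4)}{\lambda_1\lambda_2\lambda_3\lambda_4}}\pmod{q^7}.$$ (2) $|\omega_\pi|=\omega^c_\pi$ for every solid partition $\pi$ with $\pi_{111}=1$, where here $\omega_\pi$ is defined by $(\ast)$ with $d=1$. (3) $|\omega_\pi|=\omega^c_\pi$ for each of the following solid partitions, with the indicated values: all $\pi$ with $\pi_{ijk}=0$ unless $i=j=1$ and $|\pi|\leqslant10$, with $|\omega_\pi|=\omega^c_\pi=\prod_{k=1}^\infty\frac{1}{(\pi_{11k}-\pi_{11,k+1})!}$; $Z_\pi=1+t_1+t_2+t_1t_2+t_3+t_4+t_4^2$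 (value $\tfrac32$); $Z_\pi=1+t_1+t_2+t_1t_2+t_3+t_4+t_1t_4+t_4^2$ (value $3$); $Z_\pi=1+t_1+t_1^2+t_2+t_1t_2+t_3+t_4+t_1t_4+t_4^2$ (value $6$); $Z_\pi=1+t_1+t_1^2+t_2+t_1t_2+t_2t_3+t_3+t_4+t_1t_4+t_4^2$ (value $2$); $Z_\pi=1+t_1+t_1^2+t_2+t_1t_2+t_2t_3+t_3+t_4+t_1t_4+t_2t_4+t_4^2$ (value $8$); $Z_\pi=1+t_1+t_1^2+t_2+t_1t_2+t_2t_3+t_3+t_4+t_1t_4+t_2t_4+t_4^2+t_4^3$ (value $6$); $Z_\pi=1+t_1+t_1^2+t_2+t_1t_2+t_2t_3+t_3+t_4+t_1t_4+t_2t_4+t_4^2+t_4^3+t_4^4$ (value $\tfrac83$); $Z_\pi=1+t_1+t_1^2+t_2+t_1t_2+t_2t_3+t_3+t_4+t_1t_4+t_2t_4+t_4^2+t_4^3+t_4^4+t_4^5$ (value $\tfrac56$); $Z_\pi=1+t_1+t_1^2+t_2+t_2^2+t_1t_2+t_2t_3+t_3+t_4+t_1t_4+t_2t_4+t_4^2+t_4^3+t_4^4+t_4^5$ (value $\tfrac53$).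
   Context: A solid partition $\pi=\{\pi_{ijk}\}_{i,j,k\geqslant1}$ is a sequence of non-negative integers with $\pi_{ijk}\geqslant\pi_{i+1,j,k}$, $\pi_{ijk}\geqslant\pi_{i,j+1,k}$, $\pi_{ijk}\geqslant\pi_{i,j,k+1}$ for all $i,j,k\geqslant1$ and finite size $|\pi|:=\sum\pi_{ijk}<\infty$. Put $$Z_\pi=\sum_{i,j,k\geqslant1}\sum_{l=1}^{\pi_{ijk}}t_1^{i-1}t_2^{j-1}t_3^{k-1}t_4^{l-1},$$ and let $\overline{(\cdot)}$ be the involution on Laurent polynomials with $t_i\mapsto t_i^{-1}$. Define $$\mathsf{V}_\pi:=Z_\pi+\frac{\overline{Z}_\pi}{t_1t_2t_3t_4}-\frac{Z_\pi\overline{Z}_\pi(1-t_1)(1-t_2)(1-t_3)(1-t_4)}{t_1t_2t_3t_4}.$$ $K=\mathbb{Q}(\lambda_1,\lambda_2,\lambda_3,\lambda_4)/(\lambda_1+\lambda_2+\lambda_3+\lambda_4)$ denotes the field $\mathbb{Q}(\lambda_1,\lambda_2,\lambda_3)$ with $\lambda_4:=-(\lambda_1+\lambda_2+\lambda_3)$. After specializing $t_1t_2t_3t_4=1$ (i.e. identifying $t^w$ and $t^{w'}$ when $w-w'\in\mathbb{Z}(1,1,1,1)$), write $\mathsf{V}_\pi=\sum_w c_w t^w$, $w\in\mathbb{Z}^4/\mathbb{Z}(1,1,1,1)$, and set $e_T(-\mathsf{V}_\pi):=\prod_w(w_1\lambda_1+w_2\lambda_2+w_3\lambda_3+w_4\lambda_4)^{-c_w}\in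 K$; the coefficient $c_0$ of the trivial weight is $\leqslant0$, with the conventions $0^0=1$ and $e_T(-\mathsf V_\pi)=0$ if $c_0<0$. The element $(-1)^{|\pi|}e_T(-\mathsf{V}_\pi)$ is a square in $K$, and $\mathsf{w}_\pi:=\pm\sqrt{(-1)^{|\pi|}e_T(-\mathsf{V}_\pi)}\in K$ is defined up to sign (so without a sign choice only $|\omega_\pi|$ is defined). Also $$L_\pi(d_1,d_2,d_3,d_4):=\prod_{i,j,k\geqslant1}\prod_{l=1}^{\pi_{ijk}}\big((d_1+i-1)\lambda_1+(d_2+j-1)\lambda_2+(d_3+k-1)\lambda_3+(d_4+l-1)\lambda_4\big).$$ $M(q)=\prod_{n\geqslant1}(1-q^n)^{-n}$ is the MacMahon function and $M(-q)^a:=\exp(a\log M(-q))$. In $(\ast)$, $d$ is a formal variable. The existence and uniqueness of the signs in (1) is a known fact. A plane partition $\xi=\{\xi_{ij}\}_{i,j\geqslant1}$ is a sequence of non-negative integers with $\xi_{ij}\geqslant\xi_{i+1,j}$, $\xi_{ij}\geqslant\xi_{i,j+1}$ and $|\xi|:=\sum\xi_{ij}<\infty$; put $\xi(i,j,k):=1$ if $k\leqslant\xi_{ij}$ and $0$ otherwise. For a non-empty solid partition $\pi$, let $\mathcal{C}_\pi$ be the (finite) set of families $\{m_\xi\}_\xi$ of non-negative integers, indexed by all non-empty plane partitions $\xi$, such that $\pi_{ijk}=\sum_\xi m_\xi\,\xi(i,j,k)$ for all $i,j,k\geqslant1$. Define $\omega^c_\pi:=\sum_{\{m_\xi\}\in\mathcal{C}_\pi}\prod_\xi\frac{1}{(m_\xi)!}$,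 and $\omega^c_\varnothing:=1$. *)

(* Defs.v *)
From HB Require Import structures.
From mathcomp Require Import all_boot all_order all_algebra.
From mathcomp Require Import fraction finmap.
From mathcomp Require Import monalg mpoly.
From mathcomp Require Import boolp classical_sets functions cardinality fsbigop.

Set Implicit Arguments.
Unset Strict Implicit.
Unset Printing Implicit Defensive.

Import Order.TTheory GRing.Theory Num.Theory.
Local Open Scope ring_scope.

(* Indices of partitions start at 0: pi (i, j, k) stands for the entry        *)
(* pi_{i+1,j+1,k+1} of the usual 1-based convention.                          *)

(* Laurent polynomials in t_1, ..., t_4 with integer coefficients, i.e. the   *)
(* group ring of Z^4. The ring structure that monalg puts on {malg int[M]}    *)
(* requires a monoid M without nontrivial units, so that the group case is    *)
(* built on an alias.                                                         *)

Notation wt := (int * int * int * int)%type.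

Definition laurent : Type := monalg.malg wt int.
HB.instance Definition _ := GRing.Zmodule.on laurent.

Definition lcoef (p : laurent) (w : wt) : int := monalg.mcoeff w p.

Definition lsupp (p : laurent) : {fset wt} := monalg.msupp p.

HB.lock Definition lterm (c : int) (w : wt) : laurent := monalg.mkmalgU w c.

Definition tm (w : wt) : laurent := lterm 1 w.

HB.lock Definition lmul (p q : laurent) : laurent :=
  \sum_(v <- lsupp p) \sum_(w <- lsupp q) lterm (lcoef p v * lcoef q w) (v + w).

Definition lpush (f : wt -> wt) (p : laurent) : laurent :=
  \sum_(w <- lsupp p) lterm (lcoef p w) (f w).

Lemma laurentP (p q : laurent) : lcoef p =1 lcoef q <-> p = q.
Proof. exact: (monalg.malgP p q). Qed.

Lemma ltermD w : {morph lterm^~ w : c d / c + d}.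
Proof. by rewrite lterm.unlock; exact: monalg.monalgUD. Qed.

Lemma lterm0 w : lterm 0 w = 0.
Proof. by rewrite lterm.unlock; exact: monalg.monalgU0. Qed.

Lemma lcoef_term c w v : lcoef (lterm c w) v = c *+ (w == v).
Proof. by rewrite lterm.unlock; exact: monalg.mcoeffU. Qed.

Lemma laurentE p : p = \sum_(w <- lsupp p) lterm (lcoef p w) w.
Proof. by rewrite lterm.unlock; exact: monalg.monalgE. Qed.

Lemma lcoefNsupp p w : w \notin lsupp p -> lcoef p w = 0.
Proof. exact: monalg.mcoeff_outdom. Qed.

Lemma lmulw (A B : {fset wt}) p q :
  (lsupp p `<=` A)%fset -> (lsupp q `<=` B)%fset ->
  lmul p q = \sum_(v <- A) \sum_(w <- B) lterm (lcoef p v * lcoef q w) (v + w).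
Proof.
move=> sA sB; rewrite lmul.unlock (big_fset_incl _ sA) /=.
  apply: eq_bigr => v _; apply: big_fset_incl => // w _ /lcoefNsupp ->.
  by rewrite mulr0 lterm0.
by move=> v _ /lcoefNsupp pv; rewrite big1 // => w _; rewrite pv mul0r lterm0.
Qed.

Lemma lmulC : commutative lmul.
Proof.
move=> p q; rewrite lmul.unlock exchange_big; apply: eq_bigr => v _.
by apply: eq_bigr => w _; rewrite mulrC addrC.
Qed.

Lemma lmulDl : left_distributive lmul +%R.
Proof.
move=> p q r.
rewrite (@lmulw (lsupp p `|` lsupp q)%fset (lsupp r) p r) ?fsubsetUl //.
rewrite (@lmulw (lsupp p `|` lsupp q)%fset (lsupp r) q r) ?fsubsetUr //.
rewrite (@lmulw (lsupp p `|` lsupp q)%fset (lsupp r) (p + q) r) ?monalg.msuppD_le //.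
rewrite -big_split; apply: eq_bigr => v _.
rewrite -big_split; apply: eq_bigr => w _.
by rewrite /= -ltermD -mulrDl /lcoef monalg.mcoeffD.
Qed.

Lemma lmulDr : right_distributive lmul +%R.
Proof. by move=> p q r; rewrite !(lmulC p) lmulDl. Qed.

Lemma lmul0l p : lmul 0 p = 0.
Proof. by rewrite lmul.unlock /lsupp monalg.msupp0 big_seq_fset0. Qed.

Lemma lmul0r p : lmul p 0 = 0.
Proof. by rewrite lmulC lmul0l. Qed.

Lemma lmul_term c d v w : lmul (lterm c v) (lterm d w) = lterm (c * d) (v + w).
Proof.
have le c' u : (lsupp (lterm c' u) `<=` [fset u])%fset.
  by rewrite lterm.unlock monalg.msuppU_le.
rewrite (lmulw (le c v) (le d w)) !big_seq_fset1.
by rewrite /lcoef lterm.unlock !monalg.mcoeffUU.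
Qed.

Lemma lmul_suml (I : Type) (s : seq I) F q :
  lmul (\sum_(i <- s) F i) q = \sum_(i <- s) lmul (F i) q.
Proof. by apply: (big_morph (lmul^~ q)) => [x y|]; rewrite ?lmulDl ?lmul0l. Qed.

Lemma lmul_sumr (I : Type) (s : seq I) F p :
  lmul p (\sum_(i <- s) F i) = \sum_(i <- s) lmul p (F i).
Proof. by apply: (big_morph (lmul p)) => [x y|]; rewrite ?lmulDr ?lmul0r. Qed.

Lemma lmulEl p q :
  lmul p q = \sum_(v <- lsupp p) lmul (lterm (lcoef p v) v) q.
Proof. by rewrite {1}(laurentE p) lmul_suml. Qed.

Lemma lmulEr p q :
  lmul p q = \sum_(w <- lsupp q) lmul p (lterm (lcoef q w) w).
Proof. by rewrite lmulC lmulEl; apply: eq_bigr => w _; rewrite lmulC. Qed.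

Lemma lmulA : associative lmul.
Proof.
move=> p q r.
rewrite (lmulEl p (lmul q r)) (lmulEl p q) (lmul_suml _ _ r).
apply: eq_bigr => u _; set T := lterm _ u.
rewrite (lmulEl q r) (lmul_sumr _ _ T) (lmulEr T q) (lmul_suml _ _ r).
apply: eq_bigr => v _; rewrite {}/T lmul_term.
rewrite (lmulEr _ r) [LHS]lmul_sumr [RHS]lmulEr.
by apply: eq_bigr => w _; rewrite !lmul_term mulrA addrA.
Qed.

Lemma lmul1 : left_id (tm 0) lmul.
Proof.
move=> p; rewrite {1}(laurentE p) lmul_sumr [RHS]laurentE.
by apply: eq_bigr => w _; rewrite lmul_term mul1r add0r.
Qed.

Lemma lone_neq0 : tm 0 != 0.
Proof.
apply/eqP => /(congr1 (lcoef^~ 0)).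
by rewrite lcoef_term eqxx /lcoef monalg.mcoeff0.
Qed.

HB.instance Definition _ :=
  GRing.Zmodule_isComNzRing.Build laurent lmulA lmulC lmul1 lmulDl lone_neq0.

Definition t1 : laurent := tm (1, 0, 0, 0).
Definition t2 : laurent := tm (0, 1, 0, 0).
Definition t3 : laurent := tm (0, 0, 1, 0).
Definition t4 : laurent := tm (0, 0, 0, 1).

Definition bar : laurent -> laurent := lpush -%R.

(* Specialization t1 t2 t3 t4 = 1; the class of w in Z^4 / Z(1,1,1,1) is      *)
(* represented by its element with last component 0.                         *)
Definition cy_wt (w : wt) : wt := let: (a, b, c, d) := w in
  (a - d, b - d, c - d, 0).

Definition cy : laurent -> laurent := lpush cy_wt.


Notation array3 := {fsfun nat * nat * nat -> nat with 0%N}.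

Definition is_solid (pi : array3) : Prop := forall i j k : nat,
  [/\ (pi (i.+1, j, k) <= pi (i, j, k))%N,
      (pi (i, j.+1, k) <= pi (i, j, k))%N
    & (pi (i, j, k.+1) <= pi (i, j, k))%N].

Definition psize (pi : array3) : nat := (\sum_(x <- finsupp pi) pi x)%N.

Definition Zpi (pi : array3) : laurent :=
  \sum_(x <- finsupp pi) \sum_(l < pi x)
    tm (x.1.1%:Z, x.1.2%:Z, x.2%:Z, l%:Z).

Definition Vpi (pi : array3) : laurent :=
  let Z := Zpi pi in
  let invt := tm (-1, -1, -1, -1) in
  Z + bar Z * invt
    - Z * bar Z * ((1 - t1) * (1 - t2) * (1 - t3) * (1 - t4)) * invt.


(* K is Q(lambda_1, lambda_2, lambda_3). The notation {mpoly rat[3]} is       *)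
(* avoided since monalg binds it to a different type in type_scope.           *)
Definition K : fieldType := {fraction mpoly 3 rat}.

Definition lam1 : K := tofrac 'X_(@Ordinal 3 0 isT).
Definition lam2 : K := tofrac 'X_(@Ordinal 3 1 isT).
Definition lam3 : K := tofrac 'X_(@Ordinal 3 2 isT).
Definition lam4 : K := - (lam1 + lam2 + lam3).

Definition lam_wt (w : wt) : K := let: (a, b, c, d) := w in
  a%:~R * lam1 + b%:~R * lam2 + c%:~R * lam3 + d%:~R * lam4.

(* The trivial weight needs no separate treatment: it contributes 0 ^ (- c_0),*)
(* which is 0 if c_0 < 0 and which does not occur in the product if c_0 = 0.  *)
Definition eT_negV (pi : array3) : K :=
  let c := cy (Vpi pi) in
  \prod_(w <- lsupp c) lam_wt w ^ (- lcoef c w).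

Definition is_wpi (pi : array3) (w : K) : Prop :=
  w ^+ 2 = (-1) ^+ psize pi * eT_negV pi.

(* The d_i are taken in a commutative K-algebra, so that they may be scalars  *)
(* (in K^o) as well as a formal variable (in {poly K}).                       *)
Definition Lpi (A : comAlgType K) (pi : array3) (d1 d2 d3 d4 : A) : A :=
  \prod_(x <- finsupp pi) \prod_(l < pi x)
    (lam1 *: (d1 + x.1.1%:R) + lam2 *: (d2 + x.1.2%:R)
     + lam3 *: (d3 + x.2%:R) + lam4 *: (d4 + l%:R)).

(* Power series in q, computed modulo q^N.                                    *)

Definition macmahon (N : nat) : {poly K} :=
  \prod_(1 <= n < N) (\sum_(k < N) 'X^(n * k)) ^+ n.

(* For f with constant coefficient 1. *)
Definition log_series (N : nat) (f : {poly K}) : {poly K} :=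
  \sum_(1 <= k < N) ((-1) ^+ k.+1 / k%:R) *: (f - 1) ^+ k.

(* For f with constant coefficient 0. *)
Definition exp_series (N : nat) (f : {poly K}) : {poly K} :=
  \sum_(k < N) (k`!%:R)^-1 *: f ^+ k.

Definition macmahon_neg_pow (N : nat) (a : K) : {poly K} :=
  take_poly N (exp_series N (a *: log_series N (macmahon N \Po (- 'X)))).

Definition gen_series (N : nat) (w : array3 -> K) (d1 d2 d3 d4 : int)
  : {poly K} :=
  \sum_(pi \in [set pi | is_solid pi /\ (psize pi < N)%N]%classic)
    ((Lpi pi (d1%:~R : K^o) d2%:~R d3%:~R d4%:~R : K) * w pi) *: 'X^(psize pi).

Definition macmahon_exponent (d1 d2 d3 d4 : int) : K :=
  lam_wt (d1, d2, d3, d4)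
  * (- (lam1 * lam2 * lam3) - lam1 * lam2 * lam4
     - lam1 * lam3 * lam4 - lam2 * lam3 * lam4)
  / (lam1 * lam2 * lam3 * lam4).

(* Specialization lambda_1 + lambda_2 + lambda_3 = 0, defined on the local    *)
(* ring of K at the prime (lambda_1 + lambda_2 + lambda_3), with values in    *)
(* the residue field Q(lambda_1, lambda_2).                                   *)

Definition K0 : fieldType := {fraction mpoly 2 rat}.

Definition restr (p : mpoly 3 rat) : mpoly 2 rat :=
  let x1 := 'X_(@Ordinal 2 0 isT) in
  let x2 := 'X_(@Ordinal 2 1 isT) in
  p \mPo [tuple x1; x2; - x1 - x2].

Definition specializes_to (x : K) (y : K0) : Prop :=
  exists a b : mpoly 3 rat,
    [/\ restr b != 0, x = tofrac a / tofrac b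
      & y = tofrac (restr a) / tofrac (restr b)].

Lemma specializes_to_inj x y y' :
  specializes_to x y -> specializes_to x y' -> y = y'.
Proof.
have restr0 b : restr b != 0 -> tofrac b != 0.
  by rewrite tofrac_eq0; apply: contraNneq => ->; rewrite /restr raddf0.
move=> [a [b [b0 -> ->]]] [c [d [d0 /eqP + ->]]].
rewrite eqr_div ?restr0 // -!tofracM tofrac_eq => /eqP /(congr1 restr).
rewrite /restr !rmorphM /= => e; apply/eqP.
by rewrite eqr_div ?tofrac_eq0 // -!tofracM tofrac_eq /restr e.
Qed.

Definition rat_K0 (c : rat) : K0 := tofrac (mpolyC 2 c).

Definition is_omega (pi : array3) (w : K) (om : rat) : Prop :=
  let lhs : {poly K} := w *: Lpi pi 0 0 0 (- 'X) in
  let rhs : {poly rat} :=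
    ((-1) ^+ psize pi * om) *: \prod_(l < pi (0, 0, 0)%N) ('X - l%:R%:P) in
  forall n : nat, specializes_to lhs`_n (rat_K0 rhs`_n).

Lemma is_omega_uniq pi w om om' :
  is_omega pi w om -> is_omega pi w om' -> om = om'.
Proof.
move=> h h'; have e n := specializes_to_inj (h n) (h' n).
have mon : \prod_(l < pi (0, 0, 0)%N) ('X - l%:R%:P) \is @monic rat.
  exact: monic_prod_XsubC.
have := e (size (\prod_(l < pi (0, 0, 0)%N) ('X - (l%:R : rat)%:P))).-1.
rewrite /rat_K0 => /eqP; rewrite tofrac_eq mpolyC_eq !coefZ.
rewrite -lead_coefE (monicP mon) !mulr1.
have nz : (-1) ^+ psize pi != 0 :> rat by rewrite signr_eq0.
by move=> /eqP /(mulfI nz).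
Qed.

Definition is_omega_at (d : rat) (pi : array3) (w : K) (om : rat) : Prop :=
  specializes_to
    ((Lpi pi 0 0 0 (- tofrac (mpolyC 3 d) : K^o) : K) * w)
    (rat_K0 ((-1) ^+ psize pi * om * \prod_(l < pi (0, 0, 0)%N) (d - l%:R))).


Notation array2 := {fsfun nat * nat -> nat with 0%N}.

Definition is_plane (xi : array2) : Prop := forall i j : nat,
  (xi (i.+1, j) <= xi (i, j))%N /\ (xi (i, j.+1) <= xi (i, j))%N.

Definition box_in (xi : array2) (i j k : nat) : bool := (k < xi (i, j))%N.

(* Finite support of the families is no restriction: every nonempty plane     *)
(* partition contains the corner box, so at most pi (0, 0, 0) of the m xi are *)
(* nonzero.                                                                   *)
Notation plane_family := {fsfun array2 -> nat with 0%N}.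

Definition Cpi (pi : array3) : set plane_family := [set m : plane_family |
  (forall xi : array2, m xi != 0%N -> is_plane xi /\ xi <> [fsfun]) /\
  (forall i j k : nat,
     pi (i, j, k) = (\sum_(xi <- finsupp m) m xi * box_in xi i j k)%N)]%classic.

Definition omega_c (pi : array3) : rat :=
  if pi == [fsfun] then 1
  else \sum_(m \in Cpi pi) \prod_(xi <- finsupp m) (((m xi)`!%:R)^-1 : rat).

(* Main.v *)
From HB Require Import structures.
Require Import Defs.
From mathcomp Require Import all_boot all_order all_algebra.
From mathcomp Require Import finmap.
From mathcomp Require Import classical_sets fsbigop.
From mathcomp Require Import fraction mpoly ring zify.

(** Modulo t1 t2 t3 t4 = 1 the vertex splits as V = A + bar A with
    A = Z - Z bar Z (1 - 1/t1) (1 - 1/t2) (1 - 1/t3) (called Vhalf), so that w is,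
    up to sign, the inverse of the Euler class of A. Put kappa = lambda_1 + lambda_2 + lambda_3
    and let kappa tend to 0. At t4 = 1 one has V = Z + bar Z; hence the weights of
    A that are not proportional to (1, 1, 1) contribute what the boxes of pi
    contribute to L, up to sign. The weights m (1, 1, 1) contribute powers of
    kappa, which cancel against those of L, and the rational number
    prod_m m^(- c_m), where c_m is the multiplicity of m (1, 1, 1) in A. This
    gives |omega_pi| for every pi with c_0 = 0.

    In (2) an inclusion-exclusion over the corners of the unit cube shows that
    A - bar Z t4 has no weight proportional to (1, 1, 1). In (1) and (3) the
    numbers c_m and h! omega^c_pi, where h = pi_111, are computed. The latter
    counts the ordered h-tuples of plane partitions with sum pi.

    For the signs in (1), the identity at d = (0, 0, 0, -6) specializes to
    M(-q)^6, so that the sum of omega_pi 6 (6 - 1) ... (6 - h + 1) over |pi| = n is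
    the coefficient of M(q)^6. The same sum with omega^c_pi has the same value,
    and |omega_pi| = omega^c_pi, so all the omega_pi are positive. *)

Set Implicit Arguments.
Unset Strict Implicit.
Unset Printing Implicit Defensive.

Import Order.TTheory GRing.Theory Num.Theory.
Local Open Scope ring_scope.

(** The specialization is defined only on the local ring at $\kappa$, so all powers of $\kappa$ have
    to cancel inside $K$ beforehand. This is why a weight is factored into a part with nonzero
    limit, a power of $\kappa$ and a rational number, each extended multiplicatively to Laurent
    polynomials. No quotient of the Laurent ring is formed: a functional with period $v$ kills the
    multiples of $t^v-1$, which does the work of setting $t_1t_2t_3t_4=1$ or $t_4=1$.

    The square root in $\mathsf w_\pi$ and the comparison of $A$ with $Z$, made through squares,
    each leave a sign open.

    The number 6 in the sign argument: heights satisfy $h\leqslant|\pi|\leqslant6$, so all products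
    $6(6-1)\cdots(6-h+1)$ are positive, while a smaller positive integer would erase the tallest
    partitions.

    In (2) the partition may contain diagonal boxes $(i,i,i)$ away from the corner. The left side of
    $(\ast)$ is then a multiple of $d(d+1)\cdots$ and not proportional to $d$, so only $d=1$ is
    compared; there the product of the $i+1$ over the diagonal boxes (indices from 0) cancels the
    weights of $\overline{Z}t_4$. *)

Local Notation pos := (nat * nat * nat)%type.
Local Notation nb := (nat * nat * nat * nat)%type.

(** * Functionals on Laurent polynomials *)

Lemma lcoefD p q w : lcoef (p + q) w = lcoef p w + lcoef q w.
Proof. exact: monalg.mcoeffD. Qed.

Lemma lcoef0 w : lcoef 0 w = 0.
Proof. exact: monalg.mcoeff0. Qed.

Lemma lcoef_neq0 p w : (lcoef p w != 0) = (w \in lsupp p).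
Proof. exact: monalg.mcoeff_neq0. Qed.

Lemma lcoef_sum (I : Type) (s : seq I) (F : I -> laurent) w :
  lcoef (\sum_(i <- s) F i) w = \sum_(i <- s) lcoef (F i) w.
Proof.
by apply: (big_morph (lcoef^~ w)) => [p q|]; rewrite ?lcoefD ?lcoef0.
Qed.

Lemma tmD v w : tm v * tm w = tm (v + w).
Proof. exact: (lmul_term 1 1). Qed.

Lemma tm0 : tm 0 = 1.
Proof. by []. Qed.

Section Fold.
Variables (T : Type) (idx : T) (op : Monoid.com_law idx).
Variable h : int -> wt -> T.
Hypothesis h0 : forall w, h 0 w = idx.
Hypothesis hD : forall c d w, h (c + d) w = op (h c w) (h d w).

Definition lfold p := \big[op/idx]_(w <- lsupp p) h (lcoef p w) w.

Lemma lfoldW (B : {fset wt}) p : (lsupp p `<=` B)%fset ->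
  lfold p = \big[op/idx]_(w <- B) h (lcoef p w) w.
Proof. by move=> sB; apply: big_fset_incl => // w _ /lcoefNsupp ->. Qed.

(** Additivity of [h] in the coefficient makes zero coefficients harmless, so both supports may be
    replaced by their union. [lpush], [lprod] and [lsum] are all instances. *)
Lemma lfoldD p q : lfold (p + q) = op (lfold p) (lfold q).
Proof.
pose B := (lsupp p `|` lsupp q)%fset.
rewrite (@lfoldW B) ?monalg.msuppD_le // (@lfoldW B) ?fsubsetUl //.
rewrite (@lfoldW B q) ?fsubsetUr // -big_split.
by apply: eq_bigr => w _; rewrite lcoefD hD.
Qed.

Lemma lfold0 : lfold 0 = idx.
Proof. by rewrite /lfold /lsupp monalg.msupp0 big_seq_fset0. Qed.

Lemma lfold_term c w : lfold (lterm c w) = h c w.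
Proof.
rewrite (@lfoldW [fset w]%fset) ?big_seq_fset1 ?lcoef_term ?eqxx //.
by rewrite lterm.unlock monalg.msuppU_le.
Qed.

End Fold.

Lemma lpushE f p :
  lpush f p = lfold (idx := 0) +%R (fun c w => lterm c (f w)) p.
Proof. by []. Qed.

Lemma lpushD f p q : lpush f (p + q) = lpush f p + lpush f q.
Proof.
by rewrite !lpushE lfoldD // => [w|c d w]; rewrite ?lterm0 ?ltermD.
Qed.

Lemma lpush0 f : lpush f 0 = 0.
Proof. by rewrite lpushE lfold0. Qed.

Lemma lpush_sum f (I : Type) (s : seq I) (F : I -> laurent) :
  lpush f (\sum_(i <- s) F i) = \sum_(i <- s) lpush f (F i).
Proof. exact: (big_morph _ (lpushD f) (lpush0 f)). Qed.

Lemma lpushN f p : lpush f (- p) = - lpush f p.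
Proof. by apply/eqP; rewrite -addr_eq0 -lpushD addNr lpush0. Qed.

Lemma lpush_term f c w : lpush f (lterm c w) = lterm c (f w).
Proof.
by rewrite lpushE lfold_term // => v; rewrite lterm0.
Qed.

Lemma lcoef_push f p w :
  lcoef (lpush f p) w != 0 -> exists v, f v = w.
Proof.
rewrite lcoef_sum; have [/hasP[v _ /eqP]|/hasPn nf] :=
  boolP (has (fun v => f v == w) (lsupp p)); first by exists v.
rewrite big_seq big1 ?eqxx // => v /nf /negPf fv.
by rewrite lcoef_term fv.
Qed.

Lemma barM p q : bar (p * q) = bar p * bar q.
Proof.
have barD := lpushD -%R; rewrite (laurentE p) (laurentE q).
rewrite {1 2}/bar [_ * _]lmul_suml !lpush_sum [RHS]lmul_suml.
apply: eq_bigr => v _; rewrite /bar lmul_sumr !lpush_sum [RHS]lmul_sumr.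
by apply: eq_bigr => w _; rewrite lmul_term !lpush_term lmul_term opprD.
Qed.

Lemma bar_tm w : bar (tm w) = tm (- w).
Proof. exact: lpush_term. Qed.

Lemma bar1 : bar 1 = 1.
Proof. by rewrite -tm0 bar_tm oppr0. Qed.

Lemma barD p q : bar (p + q) = bar p + bar q.
Proof. exact: lpushD. Qed.

Lemma barN p : bar (- p) = - bar p.
Proof. exact: lpushN. Qed.

Lemma barK p : bar (bar p) = p.
Proof.
rewrite [RHS]laurentE {2}/bar /lpush /bar lpush_sum.
by apply: eq_bigr => w _; rewrite lpush_term opprK.
Qed.

Section Lprod.
Variable F : fieldType.
Implicit Types (g : wt -> F) (p q : laurent).

(** For [g = lam_wt] this is the Euler class. Additivity in [p] needs a base that never vanishes, so
    it is applied to variants of [lam_wt] that take the value 1 where the weight, or its limit,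
    vanishes. *)
Definition lprod g p : F := \prod_(w <- lsupp p) g w ^ lcoef p w.

Definition nz g := forall w, g w != 0.

Lemma lprodD {g} : nz g -> forall p q, lprod g (p + q) = lprod g p * lprod g q.
Proof.
move=> g0 p q.
apply: (@lfoldD _ _ _ (fun c w => g w ^ c)) => // c d w.
by rewrite /= expfzDr.
Qed.

Lemma lprod0 g : lprod g 0 = 1.
Proof. exact: (@lfold0 _ _ _ (fun c w => g w ^ c)). Qed.

Lemma lprod_term g c w : lprod g (lterm c w) = g w ^ c.
Proof. exact: (@lfold_term _ _ _ (fun c w => g w ^ c)). Qed.

Lemma lprod_tm g w : lprod g (tm w) = g w.
Proof. exact: lprod_term. Qed.

Lemma lprod_sum {g} : nz g -> forall (I : Type) (s : seq I) (G : I -> laurent),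
  lprod g (\sum_(i <- s) G i) = \prod_(i <- s) lprod g (G i).
Proof. by move=> g0 *; exact: (big_morph _ (lprodD g0) (lprod0 g)). Qed.

Lemma lprod_neq0 {g} : nz g -> forall p, lprod g p != 0.
Proof.
by move=> g0 p; rewrite prodf_seq_neq0; apply/allP => w _; rewrite /= expfz_neq0.
Qed.

Lemma lprodN {g} : nz g -> forall p, lprod g (- p) = (lprod g p)^-1.
Proof.
move=> g0 p; apply: (mulIf (lprod_neq0 g0 p)).
by rewrite -(lprodD g0) addNr lprod0 mulVf ?lprod_neq0.
Qed.

Lemma eq_lprod g g' p : g =1 g' -> lprod g p = lprod g' p.
Proof. by move=> e; apply: eq_bigr => w _; rewrite e. Qed.

Lemma lprodMl g g' p : lprod (fun w => g w * g' w) p = lprod g p * lprod g' p.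
Proof. by rewrite -big_split; apply: eq_bigr => w _; rewrite /= expfzMl. Qed.

Lemma lprod_push {g} : nz g -> forall f p, lprod g (lpush f p) = lprod (g \o f) p.
Proof.
move=> g0 f p; rewrite (lprod_sum g0).
by apply: eq_bigr => w _; rewrite lprod_term.
Qed.

Lemma lprodM_tm {g} : nz g -> forall p v,
  lprod g (p * tm v) = lprod (fun w => g (w + v)) p.
Proof.
move=> g0 p v; rewrite {1}(laurentE p) [_ * _]lmul_suml (lprod_sum g0).
by apply: eq_bigr => w _; rewrite lmul_term mulr1 lprod_term.
Qed.

End Lprod.

Section Lsum.
Implicit Types (g : wt -> int) (p q : laurent).

Definition lsum g p : int := \sum_(w <- lsupp p) lcoef p w * g w.

Lemma lsumD g p q : lsum g (p + q) = lsum g p + lsum g q.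
Proof.
apply: (@lfoldD _ _ _ (fun c w => c * g w)) => [w|c d w]; rewrite ?mul0r //.
by rewrite /= mulrDl.
Qed.

Lemma lsum0 g : lsum g 0 = 0.
Proof. exact: (@lfold0 _ _ _ (fun c w => c * g w)). Qed.

Lemma lsum_term g c w : lsum g (lterm c w) = c * g w.
Proof.
by apply: (@lfold_term _ _ _ (fun c w => c * g w)) => v; rewrite mul0r.
Qed.

Lemma lsum_tm g w : lsum g (tm w) = g w.
Proof. by rewrite lsum_term mul1r. Qed.

Lemma lsum_sum g (I : Type) (s : seq I) (G : I -> laurent) :
  lsum g (\sum_(i <- s) G i) = \sum_(i <- s) lsum g (G i).
Proof. exact: (big_morph _ (lsumD g) (lsum0 g)). Qed.

Lemma lsumN g p : lsum g (- p) = - lsum g p.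
Proof. by apply/eqP; rewrite -addr_eq0 -lsumD addNr lsum0. Qed.

Lemma eq_lsum g g' p : g =1 g' -> lsum g p = lsum g' p.
Proof. by move=> e; apply: eq_bigr => w _; rewrite e. Qed.

Lemma lsumBl g g' p : lsum (fun w => g w - g' w) p = lsum g p - lsum g' p.
Proof. by rewrite -sumrB; apply: eq_bigr => w _; rewrite mulrBr. Qed.

Lemma lsum_push g f p : lsum g (lpush f p) = lsum (g \o f) p.
Proof.
by rewrite lsum_sum; apply: eq_bigr => w _; rewrite lsum_term.
Qed.

Lemma lsumM_tm g p v : lsum g (p * tm v) = lsum (fun w => g (w + v)) p.
Proof.
rewrite {1}(laurentE p) [_ * _]lmul_suml lsum_sum.
by apply: eq_bigr => w _; rewrite lmul_term mulr1 lsum_term.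
Qed.

End Lsum.

(** Turns signs ($x=-1$) and powers of $\kappa$ into counts of weights. *)
Lemma lprod_exp (F : fieldType) (x : F) (k : wt -> int) p : x != 0 ->
  lprod (fun w => x ^ k w) p = x ^ lsum k p.
Proof.
move=> x0; rewrite /lprod /lsum (big_morph _ (fun m n => expfzDr m n x0) (expr0z x)).
by apply: eq_bigr => w _; rewrite exprz_exp mulrC.
Qed.

(** * The half of the vertex *)

Definition boxes (pi : array3) : seq wt :=
  [seq (x.1.1%:Z, x.1.2%:Z, x.2%:Z, l%:Z) | x <- finsupp pi, l <- iota 0 (pi x)].

Lemma big_boxes (T : Type) (idx : T) (op : Monoid.com_law idx) (pi : array3)
    (F : wt -> T) :
  \big[op/idx]_(b <- boxes pi) F b =
  \big[op/idx]_(x <- finsupp pi) \big[op/idx]_(l < pi x)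
    F (x.1.1%:Z, x.1.2%:Z, x.2%:Z, l%:Z).
Proof.
rewrite /boxes big_allpairs_dep; apply: eq_bigr => x _.
by rewrite -{1}[pi x]subn0 big_mkord.
Qed.

Lemma ZpiE pi : Zpi pi = \sum_(b <- boxes pi) tm b.
Proof. by rewrite big_boxes. Qed.

Lemma size_boxes pi : size (boxes pi) = psize pi.
Proof.
rewrite /boxes size_allpairs_dep sumnE big_map.
by apply: eq_bigr => x _; rewrite size_iota.
Qed.

Definition u1 : laurent := tm (-1, 0, 0, 0).
Definition u2 : laurent := tm (0, -1, 0, 0).
Definition u3 : laurent := tm (0, 0, -1, 0).

Definition Vhalf (pi : array3) : laurent :=
  Zpi pi - Zpi pi * bar (Zpi pi) * ((1 - u1) * (1 - u2) * (1 - u3)).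

(** With $P=(1-t_1)(1-t_2)(1-t_3)$ one has $P/(t_1t_2t_3)=-\overline{P}$, so the factor $1-t_4$
    produces one copy of $P$ and one of $\overline{P}$. The relation $t_1t_2t_3t_4=1$ is kept as an
    explicit multiple of $(t_1t_2t_3t_4)^{-1}-1$, which periodic functionals annihilate. *)
Lemma VhalfP pi :
  Vpi pi = Vhalf pi + bar (Vhalf pi)
    + (bar (Zpi pi) - Zpi pi * bar (Zpi pi) * ((1 - t1) * (1 - t2) * (1 - t3)))
      * (tm (-1, -1, -1, -1) - 1).
Proof.
have b1 : bar u1 = t1 by rewrite bar_tm.
have b2 : bar u2 = t2 by rewrite bar_tm.
have b3 : bar u3 = t3 by rewrite bar_tm.
have e1 : t1 * u1 = 1 by rewrite tmD -tm0.
have e2 : t2 * u2 = 1 by rewrite tmD -tm0.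
have e3 : t3 * u3 = 1 by rewrite tmD -tm0.
pose u4 : laurent := tm (0, 0, 0, -1).
have e4 : t4 * u4 = 1 by rewrite tmD -tm0.
have -> : tm (-1, -1, -1, -1) = u1 * u2 * u3 * u4 by rewrite !tmD.
rewrite /Vpi /Vhalf !(barD, barN, barM, bar1, barK) b1 b2 b3.
have -> : tm (-1, -1, -1, -1) = u1 * u2 * u3 * u4 by rewrite !tmD.
move: (Zpi pi) (bar (Zpi pi)) => Z Y.
(* The variables and their inverses become independent letters, tied only by the four relations
   handed to [ring]. *)
move: e1 e2 e3 e4; move: t1 t2 t3 t4 u1 u2 u3 u4 => a b c d a' b' c' d' e1 e2 e3 e4.
ring: e1 e2 e3 e4.
Qed.

Definition triv (w : wt) : bool := let: (a, b, c, d) := w in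
  [&& a == d, b == d & c == d].

(** The weights whose value vanishes at $\kappa=0$, that is at $\lambda_4=0$,
    $\lambda_3=-\lambda_1-\lambda_2$; hence the fourth component is ignored. *)
Definition diag (w : wt) : bool := let: (a, b, c, d) := w in
  (a == b) && (b == c).

Lemma mcoef_lin3 (a b c : rat) :
  a *: 'X_(@Ordinal 3 0 isT) + b *: 'X_(@Ordinal 3 1 isT)
  + c *: 'X_(@Ordinal 3 2 isT) = 0 :> mpoly 3 rat -> [/\ a = 0, b = 0 & c = 0].
Proof.
move=> e.
have h i := congr1 (fun p : mpoly 3 rat => p@_U_(i)%MM) e.
split.
- move: (h (@Ordinal 3 0 isT)).
  by rewrite !mcoeffD !mcoeffZ !mcoeffXU mcoeff0 /= !mulr0 !addr0 mulr1.
- move: (h (@Ordinal 3 1 isT)).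
  by rewrite !mcoeffD !mcoeffZ !mcoeffXU mcoeff0 /= !mulr0 addr0 add0r mulr1.
- move: (h (@Ordinal 3 2 isT)).
  by rewrite !mcoeffD !mcoeffZ !mcoeffXU mcoeff0 /= !mulr0 !add0r mulr1.
Qed.

Lemma mcoef_lin2 (a b : rat) :
  a *: 'X_(@Ordinal 2 0 isT) + b *: 'X_(@Ordinal 2 1 isT) = 0 :> mpoly 2 rat ->
  a = 0 /\ b = 0.
Proof.
move=> e.
have h i := congr1 (fun p : mpoly 2 rat => p@_U_(i)%MM) e.
split.
- move: (h (@Ordinal 2 0 isT)).
  by rewrite !mcoeffD !mcoeffZ !mcoeffXU mcoeff0 /= !mulr0 addr0 mulr1.
- move: (h (@Ordinal 2 1 isT)).
  by rewrite !mcoeffD !mcoeffZ !mcoeffXU mcoeff0 /= !mulr0 add0r mulr1.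
Qed.

Definition mlam (w : wt) : mpoly 3 rat := let: (a, b, c, d) := w in
  (a - d)%:~R *: 'X_(@Ordinal 3 0 isT) + (b - d)%:~R *: 'X_(@Ordinal 3 1 isT)
  + (c - d)%:~R *: 'X_(@Ordinal 3 2 isT).

Definition mlam0 (w : wt) : mpoly 2 rat := let: (a, b, c, d) := w in
  (a - c)%:~R *: 'X_(@Ordinal 2 0 isT) + (b - c)%:~R *: 'X_(@Ordinal 2 1 isT).

Definition lam0 (w : wt) : K0 := tofrac (mlam0 w).

Lemma lam_wtE w : lam_wt w = tofrac (mlam w).
Proof.
case: w => [[[a b] c] d].
rewrite /lam_wt /lam4 /lam1 /lam2 /lam3 /mlam !tofracD.
have h (k : int) (p : mpoly 3 rat) : tofrac (k%:~R *: p) = k%:~R * tofrac p :> K.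
  by rewrite scaler_int raddfMz mulrzl.
rewrite !h; ring.
Qed.

Lemma restr_mlam w : restr (mlam w) = mlam0 w.
Proof.
case: w => [[[a b] c] d]; rewrite /restr /mlam /mlam0 !comp_mpolyD !comp_mpolyZ.
rewrite !comp_mpolyXU /= !scaler_int.
ring.
Qed.

Lemma mlam_eq0 w : (mlam w == 0) = triv w.
Proof.
case: w => [[[a b] c] d]; apply/eqP/and3P => [/mcoef_lin3[]|].
  by do 3 (move/eqP; rewrite intr_eq0 subr_eq0 => ->).
by case=> /eqP -> /eqP -> /eqP ->; rewrite /mlam subrr !scale0r !addr0.
Qed.

Lemma mlam0_eq0 w : (mlam0 w == 0) = diag w.
Proof.
case: w => [[[a b] c] d]; apply/eqP/andP => [/mcoef_lin2[]|].
  do 2 (move/eqP; rewrite intr_eq0 subr_eq0 => /eqP ->); by rewrite eqxx.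
by case=> /eqP -> /eqP ->; rewrite /mlam0 subrr !scale0r !addr0.
Qed.

Lemma lam_eq0 w : (lam_wt w == 0) = triv w.
Proof. by rewrite lam_wtE tofrac_eq0 mlam_eq0. Qed.

Lemma lam0_eq0 w : (lam0 w == 0) = diag w.
Proof. by rewrite tofrac_eq0 mlam0_eq0. Qed.

(** * Specialization at kappa = 0 *)

Definition rat_K (c : rat) : K := tofrac (mpolyC 3 c).

HB.instance Definition _ := GRing.RMorphism.copy rat_K (@tofrac _ \o @mpolyC 3 rat).
HB.instance Definition _ := GRing.RMorphism.copy rat_K0 (@tofrac _ \o @mpolyC 2 rat).

Lemma rat_K0_inj : injective rat_K0.
Proof. exact: fmorph_inj. Qed.

Lemma restr_neq0 b : restr b != 0 -> b != 0.
Proof. by apply: contraNneq => ->; rewrite /restr raddf0. Qed.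

Lemma restrM a b : restr (a * b) = restr a * restr b.
Proof. by rewrite /restr rmorphM. Qed.

Lemma restrD a b : restr (a + b) = restr a + restr b.
Proof. by rewrite /restr rmorphD. Qed.

Lemma restrC c : restr (mpolyC 3 c) = mpolyC 2 c.
Proof. by rewrite /restr comp_mpolyC. Qed.

Lemma sp_tofrac a : specializes_to (tofrac a) (tofrac (restr a)).
Proof.
by exists a, 1; rewrite /restr rmorph1 !tofrac1 !divr1 oner_neq0.
Qed.

Lemma sp_rat c : specializes_to (rat_K c) (rat_K0 c).
Proof. by rewrite /rat_K0 -restrC; exact: sp_tofrac. Qed.

Lemma sp0 : specializes_to 0 0.
Proof. by have := sp_rat 0; rewrite !rmorph0. Qed.

Lemma sp1 : specializes_to 1 1.
Proof. by have := sp_rat 1; rewrite !rmorph1. Qed.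

Lemma spM {x y x' y'} : specializes_to x y -> specializes_to x' y' ->
  specializes_to (x * x') (y * y').
Proof.
move=> [a [b [b0 -> ->]]] [c [d [d0 -> ->]]]; exists (a * c), (b * d).
by split; rewrite ?restrM ?mulf_neq0 // !tofracM mulf_div.
Qed.

Lemma spD {x y x' y'} : specializes_to x y -> specializes_to x' y' ->
  specializes_to (x + x') (y + y').
Proof.
move=> [a [b [b0 -> ->]]] [c [d [d0 -> ->]]]; exists (a * d + c * b), (b * d).
split; first by rewrite restrM mulf_neq0.
  by rewrite tofracD !tofracM addf_div ?tofrac_eq0 ?restr_neq0.
by rewrite restrD !restrM tofracD !tofracM addf_div ?tofrac_eq0.
Qed.

Lemma spV {x y} : y != 0 -> specializes_to x y -> specializes_to x^-1 y^-1.
Proof.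
move=> y0 [a [b [b0 -> e]]]; have a0 : restr a != 0.
  by apply: contraNneq y0 => a0; rewrite e a0 tofrac0 mul0r.
by exists b, a; rewrite e !invf_div.
Qed.

Lemma spN {x y} : specializes_to x y -> specializes_to (- x) (- y).
Proof.
by move=> s; rewrite -[x]mul1r -[y]mul1r -!mulNr; apply: spM s; have := sp_rat (-1);
  rewrite !rmorphN !rmorph1.
Qed.

Lemma sp_exp {x y} n : specializes_to x y -> specializes_to (x ^+ n) (y ^+ n).
Proof.
move=> s; elim: n => [|n ih]; first by rewrite !expr0; exact: sp1.
by rewrite !exprS; exact: spM.
Qed.

Lemma sp_exprz {x y} (n : int) : y != 0 -> specializes_to x y ->
  specializes_to (x ^ n) (y ^ n).
Proof.
move=> y0 s; case: n => n; first exact: sp_exp.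
by apply: spV; [rewrite expf_neq0|exact: sp_exp].
Qed.

Lemma sp_prod (I : Type) (s : seq I) (F : I -> K) (G : I -> K0) :
  (forall i, specializes_to (F i) (G i)) ->
  specializes_to (\prod_(i <- s) F i) (\prod_(i <- s) G i).
Proof.
move=> h; apply: (big_ind2 specializes_to) => //; first exact: sp1.
by move=> *; exact: spM.
Qed.

Lemma sp_sum (I : Type) (s : seq I) (P : pred I) (F : I -> K) (G : I -> K0) :
  (forall i, specializes_to (F i) (G i)) ->
  specializes_to (\sum_(i <- s | P i) F i) (\sum_(i <- s | P i) G i).
Proof.
move=> h; apply: (big_ind2 specializes_to) => //; first exact: sp0.
by move=> *; exact: spD.
Qed.

Lemma sp_lprod (g : wt -> K) (g' : wt -> K0) p : nz g' ->
  (forall w, specializes_to (g w) (g' w)) ->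
  specializes_to (lprod g p) (lprod g' p).
Proof. by move=> g0 h; apply: sp_prod => w; exact: sp_exprz. Qed.

Definition pspec (p : {poly K}) (q : {poly K0}) : Prop :=
  forall n, specializes_to p`_n q`_n.

Lemma pspecC {x y} : specializes_to x y -> pspec x%:P y%:P.
Proof. by move=> s n; rewrite !coefC; case: eqP => // _; exact: sp0. Qed.

Lemma pspecX : pspec 'X 'X.
Proof. by move=> n; rewrite !coefX; case: eqP => _; [exact: sp1|exact: sp0]. Qed.

Lemma pspecD {p q p' q'} : pspec p q -> pspec p' q' -> pspec (p + p') (q + q').
Proof. by move=> h h' n; rewrite !coefD; exact: spD. Qed.

Lemma pspecM {p q p' q'} : pspec p q -> pspec p' q' -> pspec (p * p') (q * q').
Proof.
by move=> h h' n; rewrite !coefM; apply: sp_sum => i; exact: spM.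
Qed.

Lemma pspecZ {x y p q} : specializes_to x y -> pspec p q -> pspec (x *: p) (y *: q).
Proof. by move=> h h' n; rewrite !coefZ; exact: spM. Qed.

Lemma pspec_prod (I : Type) (s : seq I) (P : pred I) (F : I -> {poly K}) (G : I -> {poly K0}) :
  (forall i, P i -> pspec (F i) (G i)) ->
  pspec (\prod_(i <- s | P i) F i) (\prod_(i <- s | P i) G i).
Proof.
move=> h; apply: (big_ind2 pspec) => //; first exact: pspecC sp1.
by move=> *; exact: pspecM.
Qed.

Lemma pspec_horner p q x y : pspec p q -> specializes_to x y ->
  specializes_to p.[x] q.[y].
Proof.
move=> h s; rewrite (horner_coef_wide x (leq_maxl (size p) (size q))).
rewrite (horner_coef_wide y (leq_maxr (size p) (size q))).
by apply: sp_sum => i; apply: spM => //; exact: sp_exp.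
Qed.

Lemma wtE (a b c d a' b' c' d' : int) :
  (a, b, c, d) + (a', b', c', d') = (a + a', b + b', c + c', d + d') :> wt.
Proof. by []. Qed.

Lemma wtN (a b c d : int) : - (a, b, c, d) = (- a, - b, - c, - d) :> wt.
Proof. by []. Qed.

Lemma trivN w : triv (- w) = triv w.
Proof. by case: w => [[[a b] c] d]; rewrite wtN /= !eqr_opp. Qed.

Lemma diagN w : diag (- w) = diag w.
Proof. by case: w => [[[a b] c] d]; rewrite wtN /= !eqr_opp. Qed.

Lemma triv_cy w : triv (w + (-1, -1, -1, -1)) = triv w.
Proof. by case: w => [[[a b] c] d]; rewrite wtE /= !(inj_eq (addIr _)). Qed.

Lemma diag_cy w : diag (w + (-1, -1, -1, -1)) = diag w.
Proof. by case: w => [[[a b] c] d]; rewrite wtE /= !(inj_eq (addIr _)). Qed.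

Lemma diag_t4 w d : diag (w + (0, 0, 0, d)) = diag w.
Proof. by case: w => [[[a b] c] e]; rewrite wtE /= !addr0. Qed.

Lemma lam_wtD v w : lam_wt (v + w) = lam_wt v + lam_wt w.
Proof.
case: v w => [[[a b] c] d] [[[a' b'] c'] d']; rewrite wtE /lam_wt.
by rewrite !intrD; ring.
Qed.

Lemma lam_wtN w : lam_wt (- w) = - lam_wt w.
Proof.
by case: w => [[[a b] c] d]; rewrite wtN /lam_wt !intrN; ring.
Qed.

Lemma lam_cy w : lam_wt (w + (-1, -1, -1, -1)) = lam_wt w.
Proof.
rewrite lam_wtD -[RHS]addr0; congr (_ + _).
by apply/eqP; rewrite lam_eq0 /triv !eqxx.
Qed.

Lemma lam0D v w : lam0 (v + w) = lam0 v + lam0 w.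
Proof.
case: v w => [[[a b] c] d] [[[a' b'] c'] d']; rewrite wtE /lam0 -tofracD.
congr tofrac; rewrite /mlam0 !opprD !scaler_int; ring.
Qed.

Lemma lam0N w : lam0 (- w) = - lam0 w.
Proof.
apply/eqP; rewrite -addr_eq0 -lam0D addNr lam0_eq0.
by [].
Qed.

Lemma lam0_diag v w : diag w -> lam0 (v + w) = lam0 v.
Proof.
by rewrite -lam0_eq0 lam0D => /eqP ->; rewrite addr0.
Qed.

Section VInvariants.
Variable pi : array3.
Let invt : wt := (-1, -1, -1, -1).

Let X4 : laurent := Zpi pi * bar (Zpi pi)
  * ((1 - t1) * (1 - t2) * (1 - t3)) * tm invt.

Lemma Vpi_t4 : Vpi pi = Zpi pi + bar (Zpi pi) * tm invt + X4 * (t4 - 1).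
Proof. by rewrite /Vpi /X4 /invt; ring. Qed.

Section Prod.
Variables (F : fieldType) (g : wt -> F).
Hypothesis g0 : nz g.

Lemma lprodM_inv v p : (forall w, g (w + v) = g w) ->
  lprod g (p * tm v) = lprod g p.
Proof. by move=> gv; rewrite (lprodM_tm g0); exact: eq_lprod. Qed.

(** The substitute for setting $t^v=1$: a function with period [v] does not distinguish [p * tm v]
    from [p]. *)
Lemma lprodM_inv1 v p : (forall w, g (w + v) = g w) ->
  lprod g (p * (tm v - 1)) = 1.
Proof.
move=> gv; rewrite mulrBr mulr1 (lprodD g0) (lprodN g0) lprodM_inv //.
by rewrite divff ?lprod_neq0.
Qed.

Hypothesis gcy : forall w, g (w + invt) = g w.

Lemma lprod_V : lprod g (Vpi pi) = lprod g (Vhalf pi) * lprod g (bar (Vhalf pi)).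
Proof. by rewrite VhalfP 2!(lprodD g0) lprodM_inv1 ?mulr1. Qed.

Lemma lprod_V4 : (forall w, g (w + (0, 0, 0, 1)) = g w) ->
  lprod g (Vpi pi) = lprod g (Zpi pi) * lprod g (bar (Zpi pi)).
Proof.
by move=> g4; rewrite Vpi_t4 2!(lprodD g0) lprodM_inv1 // mulr1 lprodM_inv.
Qed.

Lemma lprod_bar k p : (forall w, g (- w) = (-1) ^ (k w : int) * g w) ->
  lprod g (bar p) = (-1) ^ lsum k p * lprod g p.
Proof.
move=> gk; rewrite (lprod_push g0) (eq_lprod (g' := fun w => (-1) ^ k w * g w)) //.
by rewrite lprodMl lprod_exp ?oppr_eq0 ?oner_eq0.
Qed.

End Prod.

Section Sum.
Variable g : wt -> int.

Lemma lsumM_inv v p : (forall w, g (w + v) = g w) -> lsum g (p * tm v) = lsum g p.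
Proof. by move=> gv; rewrite lsumM_tm; exact: eq_lsum. Qed.

Lemma lsumM_inv1 v p : (forall w, g (w + v) = g w) -> lsum g (p * (tm v - 1)) = 0.
Proof. by move=> gv; rewrite mulrBr mulr1 lsumD lsumN lsumM_inv // subrr. Qed.

Hypothesis gcy : forall w, g (w + invt) = g w.
Hypothesis gN : forall w, g (- w) = g w.

Lemma lsum_bar p : lsum g (bar p) = lsum g p.
Proof. by rewrite lsum_push; exact: eq_lsum. Qed.

Lemma lsum_V : lsum g (Vpi pi) = lsum g (Vhalf pi) *+ 2.
Proof. by rewrite VhalfP 2!lsumD lsumM_inv1 // addr0 lsum_bar mulr2n. Qed.

(** Twice either side equals [lsum g (Vpi pi)]: the left one by the splitting into [Vhalf] and its
    conjugate, the right one at $t_4=1$. The integers have no 2-torsion. *)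
Lemma lsum_V4 : (forall w, g (w + (0, 0, 0, 1)) = g w) ->
  lsum g (Vhalf pi) = lsum g (Zpi pi).
Proof.
move=> g4; apply: (@pmulrnI int 2) => //=.
by rewrite -lsum_V Vpi_t4 2!lsumD lsumM_inv1 // addr0 lsumM_inv // lsum_bar mulr2n.
Qed.

End Sum.
End VInvariants.

Definition trivz (w : wt) : int := (triv w)%:Z.
Definition diagz (w : wt) : int := (diag w)%:Z.

Lemma lsum1_Z pi : lsum (fun=> 1) (Zpi pi) = (psize pi)%:Z.
Proof.
rewrite ZpiE lsum_sum -size_boxes.
under eq_bigr do rewrite lsum_tm.
by rewrite big_const_seq count_predT iter_addr_0 natz.
Qed.

Lemma lsum1_half pi : lsum (fun=> 1) (Vhalf pi) = (psize pi)%:Z.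
Proof. by rewrite lsum_V4 // lsum1_Z. Qed.

(** The value 1 on trivial weights keeps [lprod] multiplicative; their multiplicity is followed
    separately by [trivz]. *)
Definition gK (w : wt) : K := if triv w then 1 else lam_wt w.

Lemma gK_nz : nz gK.
Proof. by move=> w; rewrite /gK; case: ifP; rewrite ?oner_eq0 ?lam_eq0 // => ->. Qed.

Lemma eT_negVE pi : lsum trivz (Vpi pi) = 0 -> eT_negV pi = (lprod gK (Vpi pi))^-1.
Proof.
move=> tV; set c := cy (Vpi pi).
have cyE w : cy_wt w = w + (- w.2, - w.2, - w.2, - w.2).
  by case: w => [[[a b] c'] d]; rewrite wtE /= subrr.
have tcy w : triv (cy_wt w) = triv w.
  by case: w => [[[a b] c'] d]; rewrite /= !subr_eq0.
have lcy w : lam_wt (cy_wt w) = lam_wt w.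
  rewrite cyE lam_wtD -[RHS]addr0; congr (_ + _).
  by apply/eqP; rewrite lam_eq0 /triv !eqxx.
have -> : lprod gK (Vpi pi) = lprod gK c.
  rewrite (lprod_push gK_nz); apply: eq_lprod => w.
  by rewrite /= /gK tcy lcy.
(* Representatives in the image of [cy_wt] have last component 0, so the only trivial one is 0. *)
have supp w : w \in lsupp c -> triv w = (w == 0).
  rewrite -lcoef_neq0 => /lcoef_push[[[[a b] c'] d] <-].
  rewrite /= !subr_eq0; apply/and3P/eqP => [[/eqP -> /eqP -> /eqP ->]|].
    by rewrite subrr.
  by move=> [/eqP + /eqP + /eqP]; rewrite !subr_eq0 => -> -> ->.
have c0 : 0 \notin lsupp c.
  rewrite -lcoef_neq0 negbK; apply/eqP; rewrite -[RHS]tV.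
  have -> : lsum trivz (Vpi pi) = lsum trivz c.
    by rewrite lsum_push; apply: eq_lsum => w; rewrite /trivz /= tcy.
  have [in0|/lcoefNsupp c0] := boolP (0 \in lsupp c).
    rewrite /lsum (bigD1_seq 0) ?fset_uniq //= mulr1 big_seq_cond big1 ?addr0 //.
    by move=> w /andP[win] /negPf w0; rewrite /trivz supp // w0 mulr0.
  rewrite c0 /lsum big_seq big1 // => w win; rewrite /trivz supp //.
  by case: eqP win => [->|]; rewrite ?mulr0 // c0 mul0r.
rewrite /eT_negV /lprod -prodfV big_seq [RHS]big_seq.
apply: eq_bigr => w win; rewrite /gK supp //.
by case: eqP win c0 => [-> ->|] //; rewrite invr_expz.
Qed.

(** Conjugation changes the sign of every nontrivial weight, and [Vhalf] has $|\pi|$ of them,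
    counted with multiplicity. Hence $e_T(-\mathsf V_\pi)=(-1)^{|\pi|}E^{-2}$ with $E$ the Euler
    class of [Vhalf], and the sign in [is_wpi] is the one that leaves a square. *)
Lemma wpi_half pi w : lsum trivz (Vhalf pi) = 0 -> is_wpi pi w ->
  exists s : bool, w = (-1) ^+ s * (lprod gK (Vhalf pi))^-1.
Proof.
move=> tA; rewrite /is_wpi eT_negVE; last first.
  rewrite lsum_V ?tA ?mul0rn // => v; rewrite /trivz ?triv_cy ?trivN //.
set E := lprod gK (Vhalf pi).
have gN v : gK (- v) = (-1) ^ (1 - trivz v) * gK v.
  by rewrite /gK /trivz trivN lam_wtN; case: (triv v); rewrite ?mulr1 ?mulN1r.
rewrite (lprod_V _ gK_nz); last by move=> v; rewrite /gK triv_cy lam_cy.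
rewrite (lprod_bar gK_nz _ gN) lsumBl tA subr0 lsum1_half -/E => e.
have /eqP : w ^+ 2 = (E^-1) ^+ 2.
  rewrite e -exprnP mulrCA -expr2 invfM invr_sign signrMK.
  by rewrite exprVn.
rewrite eqf_sqr => /orP[]/eqP ->; first by exists false; rewrite mul1r.
by exists true; rewrite mulN1r.
Qed.

Definition kap : K := lam1 + lam2 + lam3.

Lemma kap_neq0 : kap != 0.
Proof.
have -> : kap = lam_wt (1, 1, 1, 0) by rewrite /kap /lam_wt !mul1r mul0r addr0.
by rewrite lam_eq0.
Qed.

Definition dm (w : wt) : int := w.1.1.1 - w.2.

Lemma lam_diag w : diag w -> lam_wt w = (dm w)%:~R * kap.
Proof.
case: w => [[[a b] c] d] /= /andP[/eqP -> /eqP ->].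
by rewrite /dm /lam_wt /lam4 /kap /= intrB; ring.
Qed.

Lemma sp_int m : specializes_to m%:~R m%:~R.
Proof. by have := sp_rat m%:~R; rewrite !rmorph_int. Qed.

Lemma sp_lam w : specializes_to (lam_wt w) (lam0 w).
Proof. by rewrite lam_wtE /lam0 -restr_mlam; exact: sp_tofrac. Qed.

Lemma sp_kap : specializes_to kap 0.
Proof.
have -> : kap = lam_wt (1, 1, 1, 0) by rewrite /kap /lam_wt !mul1r mul0r addr0.
have -> : 0 = lam0 (1, 1, 1, 0) by apply/esym/eqP; rewrite lam0_eq0.
exact: sp_lam.
Qed.

Definition gm (w : wt) : rat :=
  if diag w && ~~ triv w then (dm w)%:~R else 1.

Definition gN (w : wt) : K := if diag w then 1 else lam_wt w.

Definition g0 (w : wt) : K0 := if diag w then 1 else lam0 w.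

Lemma triv_diag w : triv w -> diag w.
Proof.
by case: w => [[[a b] c] d] /= /and3P[/eqP -> /eqP -> /eqP ->]; rewrite eqxx.
Qed.

Lemma triv_dm w : diag w -> triv w = (dm w == 0).
Proof.
case: w => [[[a b] c] d] /= /andP[/eqP -> /eqP ->].
by rewrite /dm /= subr_eq0 !andbb.
Qed.

Lemma gm_nz : nz gm.
Proof.
move=> w; rewrite /gm; case: ifP => [/andP[dw]|_]; last exact: oner_neq0.
by rewrite triv_dm // intr_eq0.
Qed.

Lemma g0_nz : nz g0.
Proof.
by move=> w; rewrite /g0; case: ifP => dw; rewrite ?oner_neq0 // lam0_eq0 dw.
Qed.

(** Separates the behaviours at $\kappa=0$: [gN] has the nonzero limit [g0], the exponent of [kap]
    is 1 exactly on the nontrivial diagonal weights, and [gm] is a rational constant. *)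
Lemma gKE w : gK w = gN w * (kap ^ (diagz w - trivz w) * rat_K (gm w)).
Proof.
rewrite /gK /gN /gm /diagz /trivz.
have td := @triv_diag w.
case tw: (triv w); first by rewrite td //= subrr rmorph1 !mulr1.
case dw: (diag w) => /=; last by rewrite rmorph1 subrr expr0z !mulr1.
by rewrite subr0 expr1z rmorph_int mul1r mulrC lam_diag.
Qed.

Lemma lprod_gK p : lprod gK p =
  lprod gN p * (kap ^ (lsum diagz p - lsum trivz p) * rat_K (lprod gm p)).
Proof.
rewrite (eq_lprod _ gKE) !lprodMl lprod_exp ?kap_neq0 // lsumBl.
congr (_ * (_ * _)); rewrite /lprod rmorph_prod; apply: eq_bigr => w _.
by rewrite fmorphXz.
Qed.

(* At t4 = 1 the vertex V reduces to Z + bar Z, so the weights not            *)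
(* proportional to (1, 1, 1) contribute the same square to Vhalf and to Z.    *)
Lemma lprod_g0_half pi :
  exists s : bool, lprod g0 (Vhalf pi) = (-1) ^+ s * lprod g0 (Zpi pi).
Proof.
have gcy w : g0 (w + (-1, -1, -1, -1)) = g0 w by rewrite /g0 diag_cy lam0_diag.
have g4 w : g0 (w + (0, 0, 0, 1)) = g0 w by rewrite /g0 diag_t4 lam0_diag.
have gN w : g0 (- w) = (-1) ^ (1 - diagz w) * g0 w.
  by rewrite /g0 /diagz diagN lam0N; case: (diag w); rewrite ?mulr1 ?mulN1r.
have := lprod_V4 pi g0_nz gcy g4.
rewrite (lprod_V _ g0_nz gcy) !(lprod_bar g0_nz _ gN) !lsumBl.
rewrite lsum1_half lsum1_Z lsum_V4; first last.
- by move=> w; rewrite /diagz diag_t4.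
- by move=> w; rewrite /diagz diagN.
- by move=> w; rewrite /diagz diag_cy.
rewrite ![_ * (_ ^ _ * _)]mulrCA => /mulfI; rewrite expfz_neq0 ?oppr_eq0 ?oner_eq0 //.
move=> /(_ isT) /eqP; rewrite -!expr2 eqf_sqr => /orP[]/eqP ->.
  by exists false; rewrite mul1r.
by exists true; rewrite mulN1r.
Qed.

Lemma lsum_diag_Z pi : lsum diagz (Zpi pi) = (count diag (boxes pi))%:Z.
Proof.
rewrite ZpiE lsum_sum.
under eq_bigr do rewrite lsum_tm.
by elim: (boxes pi) => [|b s ih]; rewrite ?big_nil // big_cons ih /= PoszD.
Qed.

(** Since $\lambda_4=-\kappa$, the choice $d_4=-d$ adds $+\kappa d$ to the factor of each box. *)
Definition Lfac (b : wt) : {poly K} := (lam_wt b)%:P + kap *: 'X.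

(** Stated over an arbitrary field, so that [ring] works with variables rather than inside the
    fraction field [K]. *)
Lemma linear_factorE (F : fieldType) (x1 x2 x3 : F) (i j k l : nat) :
  x1 *: (0 + i%:R) + x2 *: (0 + j%:R) + x3 *: (0 + k%:R)
    + (- (x1 + x2 + x3)) *: (- 'X + l%:R)
  = (i%:~R * x1 + j%:~R * x2 + k%:~R * x3 + l%:~R * - (x1 + x2 + x3))%:P
    + (x1 + x2 + x3) *: 'X :> {poly F}.
Proof. by rewrite -!mul_polyC !pmulrn -![n in _ * (0 + n)]polyC_natr; ring. Qed.

Lemma LpiE pi : Lpi pi 0 0 0 (- 'X) = \prod_(b <- boxes pi) Lfac b.
Proof.
rewrite big_boxes; apply: eq_bigr => x _; apply: eq_bigr => l _.
exact: linear_factorE.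
Qed.

Lemma linear_factor_hornerE (F : fieldType) (x1 x2 x3 d : F) (i j k l : nat) :
  x1 * (0 + i%:R) + x2 * (0 + j%:R) + x3 * (0 + k%:R)
    + (- (x1 + x2 + x3)) * (- d + l%:R)
  = ((i%:~R * x1 + j%:~R * x2 + k%:~R * x3 + l%:~R * - (x1 + x2 + x3))%:P
    + (x1 + x2 + x3) *: 'X).[d].
Proof. by rewrite hornerD hornerC hornerZ hornerX -!pmulrn; ring. Qed.

Lemma Lpi_scalarE pi (d : K) :
  Lpi pi 0 0 0 (- d : K^o) = (\prod_(b <- boxes pi) Lfac b).[d].
Proof.
rewrite horner_prod big_boxes; apply: eq_bigr => x _; apply: eq_bigr => l _.
exact: linear_factor_hornerE.
Qed.

Lemma prod_scale_if (F : fieldType) (I : Type) (s : seq I) (P : pred I) (x : F)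
    (f h : I -> {poly F}) :
  (forall i, f i = if P i then x *: h i else h i) ->
  \prod_(i <- s) f i = x ^+ count P s *: \prod_(i <- s) h i.
Proof.
move=> fE; elim: s => [|i s ih]; first by rewrite !big_nil scale1r.
rewrite !big_cons ih fE /= exprD; case: (P i).
  by rewrite expr1 -scalerAl -scalerAr scalerA.
by rewrite expr0 mul1r -scalerAr.
Qed.

Lemma scale_linear_factor (F : fieldType) (x : F) (m : int) :
  (m%:~R * x)%:P + x *: 'X = x *: ('X + m%:~R%:P) :> {poly F}.
Proof. by rewrite scalerDr addrC -[x *: _%:P]mul_polyC -polyCM [x * _]mulrC. Qed.

Lemma prod_if_polyC (F : fieldType) (I : Type) (s : seq I) (P : pred I)
    (x : I -> F) (f : I -> {poly F}) : (forall i, ~~ P i -> x i != 0) ->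
  \prod_(i <- s | P i) f i = (\prod_(i <- s) if P i then 1 else x i)^-1 *:
    \prod_(i <- s) (if P i then f i else (x i)%:P).
Proof.
move=> x0; rewrite -mul_polyC -prodfV rmorph_prod /= -big_split big_mkcond /=.
apply: eq_bigr => i _; case: ifPn => [Pi|/x0 xi]; first by rewrite invr1 mul1r.
by rewrite -polyCM mulVf.
Qed.

Lemma cancel_factor (F : fieldType) (s x k r : F) : k != 0 ->
  s / (x * (k * r)) * k = s * (x^-1 * r^-1).
Proof.
by move=> k0; rewrite !invfM -!mulrA [r^-1 * k]mulrC (mulrA k^-1) mulVf // mul1r.
Qed.

Lemma cancel_sign (F : fieldType) (s s' : bool) (x r : F) : x != 0 ->
  (-1) ^+ (s (+) s') * r / x = (-1) ^+ s * (((-1) ^+ s' * x)^-1 * r).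
Proof.
move=> x0; rewrite invfM signr_addb invr_sign -!mulrA; congr (_ * (_ * _)).
exact: mulrC.
Qed.

(** A diagonal box gives $\kappa(d+m)$ in $L$; by [lsum_V4] the class of [Vhalf] carries exactly as
    many factors $\kappa$ as there are diagonal boxes. The other boxes lose their $d$ in the limit,
    and their product cancels the [g0] part of $w$ up to sign. *)
Theorem spec_Lw pi w : lsum trivz (Vhalf pi) = 0 -> is_wpi pi w ->
  exists s : bool,
    pspec (w *: \prod_(b <- boxes pi) Lfac b)
      (rat_K0 ((-1) ^+ s * (lprod gm (Vhalf pi))^-1) *:
       \prod_(b <- boxes pi | diag b) ('X + (dm b)%:~R%:P)).
Proof.
move=> tA /(wpi_half tA)[s ->]; have [s' e'] := lprod_g0_half pi.
exists (s (+) s'); set A := Vhalf pi in tA e' *.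
pose H b : {poly K} := if diag b then 'X + (dm b)%:~R%:P else Lfac b.
have -> : \prod_(b <- boxes pi) Lfac b =
    kap ^+ count diag (boxes pi) *: \prod_(b <- boxes pi) H b.
  apply: prod_scale_if => b; rewrite /H; case db: (diag b) => //.
  by rewrite /Lfac lam_diag // scale_linear_factor.
(* The missing factors are restored by the limits [lam0 b], so that the products before and after
   the limit run over the same boxes. *)
have -> : \prod_(b <- boxes pi | diag b) ('X + (dm b)%:~R%:P) =
    (lprod g0 (Zpi pi))^-1 *:
    \prod_(b <- boxes pi) (if diag b then 'X + (dm b)%:~R%:P else (lam0 b)%:P).
  rewrite ZpiE (lprod_sum g0_nz); under [in RHS]eq_bigr do rewrite lprod_tm.
  by apply: prod_if_polyC => b; rewrite lam0_eq0.
rewrite !scalerA; apply: pspecZ; last first.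
  apply: pspec_prod => b _; rewrite /H; case: ifP => db.
    by apply: pspecD; [exact: pspecX|apply: pspecC; exact: sp_int].
  rewrite -[(lam0 b)%:P]addr0 -[X in _ + X](scale0r ('X : {poly K0})).
  apply: pspecD; first exact: pspecC (sp_lam b).
  by apply: pspecZ; [exact: sp_kap|exact: pspecX].
rewrite lprod_gK tA subr0 lsum_V4; first last.
- by move=> v; rewrite /diagz diag_t4.
- by move=> v; rewrite /diagz diagN.
- by move=> v; rewrite /diagz diag_cy.
rewrite lsum_diag_Z -exprnP -/A.
rewrite cancel_factor ?expf_neq0 ?kap_neq0 //.
have -> : rat_K0 ((-1) ^+ (s (+) s') / lprod gm A) / lprod g0 (Zpi pi) =
   (-1) ^+ s * ((lprod g0 A)^-1 * rat_K0 ((lprod gm A)^-1)).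
  by rewrite e' rmorphM /= rmorph_sign cancel_sign // lprod_neq0 //; exact: g0_nz.
apply: spM; first by have := sp_rat ((-1) ^+ s); rewrite !rmorph_sign.
apply: spM.
  apply: spV; first exact: lprod_neq0 g0_nz _.
  apply: sp_lprod => [|w']; first exact: g0_nz.
  by rewrite /gN /g0; case: ifP => _; [exact: sp1|exact: sp_lam].
by rewrite -fmorphV; exact: sp_rat.
Qed.

(** * Computation of the diagonal weights *)

Definition emb (p : nb) : wt := let: (a, b, c, d) := p in
  (a%:Z, b%:Z, c%:Z, d%:Z).

Definition nbox0 : nb := (0%N, 0%N, 0%N, 0%N).

(* |m| if p - q is m (1, 1, 1, 0) modulo (1, 1, 1, 1). *)
Definition dval (pq : nb * nb) : option nat :=
  let: ((a, b, c, d), (a', b', c', d')) := pq in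
  if ((a + b' == b + a') && (b + c' == c + b'))%N
  then Some ((a + d' - (a' + d)) + (a' + d - (a + d')))%N else None.

Definition tm_pairs (L : seq (nb * nb)) : laurent :=
  \sum_(pq <- L) tm (emb pq.1 - emb pq.2).

Lemma eq_subz (a b c d : nat) : (a%:Z - b%:Z == c%:Z - d%:Z) = (a + d == c + b)%N.
Proof. by rewrite subr_eq addrAC -PoszD eq_sym subr_eq -PoszD eqz_nat eq_sym. Qed.

Lemma dvalP pq : dval pq =
  if diag (emb pq.1 - emb pq.2) then Some (absz (dm (emb pq.1 - emb pq.2))) else None.
Proof.
case: pq => [[[[a b] c] d] [[[a' b'] c'] d']]; rewrite /dval /emb /fst /snd.
rewrite wtN wtE /diag !eq_subz /dm /=.
case: ifP => // _; congr Some.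
have -> : a%:Z - a'%:Z - (d%:Z - d'%:Z) = (a + d')%N%:Z - (a' + d)%N%:Z.
  by rewrite !PoszD; ring.
set x := (a + d')%N; set y := (a' + d)%N.
case: (leqP x y) => xy.
  by rewrite (eqP xy) add0n distnC distnEl.
by rewrite (eqP (ltnW xy)) addn0 distnEl // ltnW.
Qed.

Lemma lprod_gm_pairs L :
  `|lprod gm (tm_pairs L)| = (\prod_(n <- pmap dval L | n != 0%N) n)%:R.
Proof.
rewrite (lprod_sum gm_nz) normr_prod; elim: L => [|pq L ih].
  by rewrite !big_nil.
rewrite big_cons ih lprod_tm [pmap dval (_ :: _)]/= dvalP /gm.
move: (emb _ - emb _) => w; case dw: (diag w) => /=; last by rewrite normr1 mul1r.
rewrite big_cons triv_dm // -absz_eq0; case: ifP => _; last by rewrite normr1 mul1r.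
by rewrite natrM natr_absz intr_norm.
Qed.

Lemma lsum_triv_pairs L :
  lsum trivz (tm_pairs L) = (count (pred1 0%N) (pmap dval L))%:Z.
Proof.
rewrite lsum_sum; elim: L => [|pq L ih]; first by rewrite big_nil.
rewrite big_cons ih lsum_tm [pmap dval (_ :: _)]/= dvalP /trivz.
move: (emb _ - emb _) => w; case dw: (diag w) => /=.
  by rewrite triv_dm // -absz_eq0 PoszD.
by case tw: (triv w); rewrite ?add0r // (triv_diag tw) in dw.
Qed.

Definition shifts (e : seq (nat * nat * nat)) (B : seq nb) : seq nb :=
  [seq let: (a, b, c, d) := q in ((a + s.1.1)%N, (b + s.1.2)%N, (c + s.2)%N, d)
     | q <- B, s <- e].

(** The vertices of the unit cube with even coordinate sum index the terms of sign $+$ in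
    $(1-t_1^{-1})(1-t_2^{-1})(1-t_3^{-1})$, those in [odds] the terms of sign $-$. *)
Definition evens : seq (nat * nat * nat) :=
  [:: (0, 0, 0); (1, 1, 0); (1, 0, 1); (0, 1, 1)]%N.
Definition odds : seq (nat * nat * nat) :=
  [:: (1, 0, 0); (0, 1, 0); (0, 0, 1); (1, 1, 1)]%N.

(** A weight is stored as a difference of two points with natural coordinates, and terms of either
    sign are kept apart, so that evaluation needs no integers. The pairs with [nbox0] stand for the
    summand $Z$. *)
Definition pos_pairs (B : seq nb) : seq (nb * nb) :=
  [seq (p, nbox0) | p <- B] ++ [seq (p, q) | p <- B, q <- shifts odds B].
Definition neg_pairs (B : seq nb) : seq (nb * nb) :=
  [seq (p, q) | p <- B, q <- shifts evens B].

Lemma big_shift q e : \sum_(s <- e)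
    tm (- emb (let: (a, b, c, d) := q in
               ((a + s.1.1)%N, (b + s.1.2)%N, (c + s.2)%N, d))) =
  tm (- emb q) * \sum_(s <- e) tm (- s.1.1%:Z, - s.1.2%:Z, - s.2%:Z, 0).
Proof.
rewrite mulr_sumr; apply: eq_bigr => s _; rewrite tmD; congr tm.
by case: q => [[[a b] c] d]; rewrite /= !wtN wtE !PoszD !opprD addr0.
Qed.

Lemma sum_pairs (B : seq nb) e :
  tm_pairs [seq (p, q) | p <- B, q <- shifts e B] =
  (\sum_(p <- B) tm (emb p)) * (\sum_(q <- B) tm (- emb q)) *
    (\sum_(s <- e) tm (- s.1.1%:Z, - s.1.2%:Z, - s.2%:Z, 0)).
Proof.
rewrite /tm_pairs big_allpairs_dep /= -mulrA mulr_suml; apply: eq_bigr => p _.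
rewrite /shifts big_allpairs_dep /= mulr_suml mulr_sumr; apply: eq_bigr => q _.
rewrite -big_shift mulr_sumr; apply: eq_bigr => s _.
by rewrite tmD.
Qed.

Lemma Vhalf_pairs pi B : perm_eq (boxes pi) (map emb B) ->
  Vhalf pi = tm_pairs (pos_pairs B) - tm_pairs (neg_pairs B).
Proof.
move=> pB; have ZE : Zpi pi = \sum_(p <- B) tm (emb p).
  by rewrite ZpiE (perm_big _ pB) big_map.
have bZE : bar (Zpi pi) = \sum_(p <- B) tm (- emb p).
  by rewrite ZE /bar lpush_sum; apply: eq_bigr => p _; rewrite lpush_term.
have -> : tm_pairs (pos_pairs B) = \sum_(p <- B) tm (emb p) +
    tm_pairs [seq (p, q) | p <- B, q <- shifts odds B].
  rewrite /pos_pairs {1}/tm_pairs big_cat big_map; congr (_ + _).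
  by apply: eq_bigr => p _; rewrite subr0.
rewrite /Vhalf bZE ZE !sum_pairs.
rewrite !big_cons !big_nil /= !oppr0 !addr0 -/u1 -/u2 -/u3 tm0.
have -> : tm (-1, -1, 0, 0) = u1 * u2 by rewrite tmD.
have -> : tm (-1, 0, -1, 0) = u1 * u3 by rewrite tmD.
have -> : tm (0, -1, -1, 0) = u2 * u3 by rewrite tmD.
have -> : tm (-1, -1, -1, 0) = u1 * u2 * u3 by rewrite !tmD.
move: u1 u2 u3 (\sum_(p <- B) tm (emb p)) (\sum_(p <- B) tm (- emb p)) => a b c x y.
by ring.
Qed.

(** Here the only diagonal boxes are those stacked over the corner; the one at level $l$ has [dm]
    equal to $-l$, which yields the falling product of $(\ast)$. *)
Lemma prod_diag_boxes (F : fieldType) (pi : array3) :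
  (forall i, pi (i.+1, i.+1, i.+1) = 0%N) ->
  \prod_(b <- boxes pi | diag b) ('X + (dm b)%:~R%:P) =
  \prod_(l < pi (0, 0, 0)%N) ('X - l%:R%:P) :> {poly F}.
Proof.
move=> hd; rewrite big_mkcond big_boxes.
have off (x : nat * nat * nat) : x \in finsupp pi -> x != (0, 0, 0)%N ->
    (x.1.1 == x.1.2) && (x.1.2 == x.2) = false.
  case: x => [[i j] k] xin x0; apply/negP => /= /andP[/eqP ij /eqP jk].
  move: xin x0; rewrite ij jk; case: k {ij jk} => // k.
  by rewrite mem_finsupp hd.
have [in0|nin0] := boolP ((0, 0, 0)%N \in finsupp pi); last first.
  rewrite (fsfun_dflt nin0) big_ord0 big_seq big1 // => x xin.
  apply: big1 => l _; rewrite /= !eqz_nat off //.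
  by apply: contraNneq nin0 => <-.
rewrite (bigD1_seq _ in0) ?fset_uniq //= [X in _ * X]big_seq_cond [X in _ * X]big1.
  rewrite mulr1; apply: eq_bigr => l _.
  by rewrite /dm /= sub0r -polyCN mulrNz.
by move=> x /andP[xin x0]; apply: big1 => l _; rewrite /= !eqz_nat off.
Qed.

Lemma map_falling (h : nat) :
  map_poly rat_K0 (\prod_(l < h) ('X - l%:R%:P)) = \prod_(l < h) ('X - l%:R%:P).
Proof.
rewrite rmorph_prod; apply: eq_bigr => l _.
by rewrite rmorphB /= map_polyX map_polyC /= rmorph_nat.
Qed.

Lemma spec_is_omega pi w : lsum trivz (Vhalf pi) = 0 ->
  (forall i, pi (i.+1, i.+1, i.+1) = 0%N) -> is_wpi pi w ->
  exists2 om : rat, is_omega pi w om & `|om| = `|lprod gm (Vhalf pi)|^-1.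
Proof.
move=> tA hd /(spec_Lw tA)[s sp].
exists ((-1) ^+ psize pi * ((-1) ^+ s * (lprod gm (Vhalf pi))^-1)); last first.
  by rewrite !normrM !normr_sign !mul1r normfV.
move=> n; have := sp n; rewrite LpiE coefZ [in X in _ -> X]coefZ.
rewrite signrMK prod_diag_boxes // [in X in _ -> X]rmorphM /=.
by rewrite -(coef_map rat_K0) map_falling coefZ.
Qed.

Definition prodnz (s : seq nat) : nat := \prod_(n <- s | n != 0%N) n.

Lemma prodnz_gt0 s : (0 < prodnz s)%N.
Proof. by apply: prodn_cond_gt0 => n; rewrite lt0n. Qed.

Lemma omega_pairs pi w (B : seq nb) : perm_eq (boxes pi) (map emb B) ->
  count (pred1 0%N) (pmap dval (pos_pairs B)) =
    count (pred1 0%N) (pmap dval (neg_pairs B)) ->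
  (forall i, pi (i.+1, i.+1, i.+1) = 0%N) -> is_wpi pi w ->
  exists2 om : rat, is_omega pi w om &
    `|om| = (prodnz (pmap dval (neg_pairs B)))%:R
            / (prodnz (pmap dval (pos_pairs B)))%:R.
Proof.
move=> pB c0 hd wpi; have VE := Vhalf_pairs pB.
have [|om h e] := spec_is_omega _ hd wpi.
  by rewrite VE lsumD lsumN !lsum_triv_pairs c0 subrr.
exists om => //; rewrite e VE (lprodD gm_nz) (lprodN gm_nz) normrM normfV.
by rewrite !lprod_gm_pairs invf_div.
Qed.

(** * Solid partitions given by lists of entries *)

Fixpoint lookup (s : seq nb) (x : pos) : nat :=
  if s is (y, v) :: s' then if y == x then v else lookup s' x else 0%N.

Definition keys (s : seq nb) : seq pos := map fst s.

Definition arr (s : seq nb) : array3 :=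
  [fsfun x in [fset y in keys s]%fset => lookup s x].

Definition wf (s : seq nb) : bool :=
  uniq (keys s) && all (fun p => p.2 != 0%N) s.

Lemma lookup_out s x : x \notin keys s -> lookup s x = 0%N.
Proof.
elim: s => //= -[y v] s ih; rewrite inE negb_or => /andP[xy /ih ->].
by rewrite eq_sym (negPf xy).
Qed.

Lemma arrE s x : arr s x = lookup s x.
Proof.
rewrite fsfunE; case: ifPn => //; rewrite !inE => xs.
by rewrite lookup_out.
Qed.

Lemma lookup_neq0 s x : all (fun p => p.2 != 0%N) s ->
  (lookup s x != 0%N) = (x \in keys s).
Proof.
elim: s => //= -[y v] s ih /= /andP[v0 /ih {}ih]; rewrite inE [x == y]eq_sym.
by case: (y =P x) => /=.
Qed.

Lemma finsupp_arr s : wf s -> perm_eq (finsupp (arr s)) (keys s).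
Proof.
move=> /andP[us nz]; apply: uniq_perm => // x.
by rewrite mem_finsupp arrE lookup_neq0.
Qed.

Lemma map_lookup s : uniq (keys s) -> [seq (x, lookup s x) | x <- keys s] = s.
Proof.
elim: s => //= -[y v] s ih /= /andP[yn us]; rewrite eqxx -[in RHS](ih us).
congr (_ :: _); apply/eq_in_map => x xs; case: eqP => // yx.
by rewrite yx xs in yn.
Qed.

Lemma big_arr (T : Type) (idx : T) (op : Monoid.com_law idx) s
    (F : pos -> nat -> T) : wf s ->
  \big[op/idx]_(x <- finsupp (arr s)) F x (arr s x) =
  \big[op/idx]_(p <- s) F p.1 p.2.
Proof.
move=> ws; rewrite (perm_big _ (finsupp_arr ws)) /=.
case/andP: ws => us _; rewrite -[in RHS](map_lookup us) big_map.
by apply: eq_bigr => x _; rewrite arrE.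
Qed.

Lemma psize_arr s : wf s -> psize (arr s) = sumn (map snd s).
Proof. by move=> ws; rewrite /psize (big_arr _ (fun=> id)) // sumnE big_map. Qed.

Definition cboxes (s : seq nb) : seq nb :=
  flatten [seq [seq (p.1, l) | l <- iota 0 p.2] | p <- s].

Lemma boxes_arr s : wf s -> perm_eq (boxes (arr s)) (map emb (cboxes s)).
Proof.
move=> ws; rewrite /boxes /cboxes map_flatten -map_comp.
rewrite [X in perm_eq X _](_ : _ = flatten
  [seq [seq emb (x, l) | l <- iota 0 (lookup s x)] | x <- finsupp (arr s)]).
  case/andP: (ws) => us _.
  rewrite -[in X in perm_eq _ X](map_lookup us) -map_comp.
  apply: perm_flatten; apply: perm_trans (perm_map _ (finsupp_arr ws)) _.
  by apply/permP => a; congr count; apply: eq_map => x /=; rewrite -map_comp.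
congr flatten; apply: eq_map => x; rewrite arrE.
by apply: eq_map => l; case: x => [[i j] k].
Qed.

(** * The combinatorial weight *)

Definition box (xi : array2) (x : pos) : bool := box_in xi x.1.1 x.1.2 x.2.

Definition upd (m : plane_family) (xi : array2) (k : nat) : plane_family :=
  [fsfun m with xi |-> k].

Lemma updE m xi k z : upd m xi k z = if z == xi then k else m z.
Proof. by rewrite /upd fsfun_withE. Qed.

Section Families.
Variable ps : seq pos.

Definition vec (xi : array2) : seq bool := [seq box xi x | x <- ps].

Definition multiplicities (xi : array2) (f : pos -> nat) : seq nat :=
  [seq k <- iota 0 (f (0, 0, 0)%N).+1 | all (fun x => k * box xi x <= f x)%N ps].

Lemma mem_multiplicities xi f k : (k \in multiplicities xi f) =
  (k <= f (0, 0, 0))%N && all (fun x => k * box xi x <= f x)%N ps.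
Proof. by rewrite mem_filter mem_iota add0n ltnS andbC. Qed.

Fixpoint families (l : seq array2) (f : pos -> nat) : seq plane_family :=
  if l is xi :: l' then
    [seq upd m xi k
       | k <- multiplicities xi f,
         m <- families l' (fun x => f x - k * box xi x)%N]
  else if all (fun x => f x == 0%N) ps then [:: [fsfun]] else [::].

(** With [lev], [levels] and [tuples] this mirrors the recursion of [families] on bit vectors and
    values alone, which can be evaluated. *)
Definition subv k (b : seq bool) (v : seq nat) : seq nat :=
  [seq if p.1 then (p.2 - k)%N else p.2 | p <- zip b v].

Definition lev k (b : seq bool) (v : seq nat) : bool :=
  all (fun p => p.1 ==> (k <= p.2)%N) (zip b v).

Definition levels (b : seq bool) (v : seq nat) : seq nat :=
  [seq k <- iota 0 (head 0%N v).+1 | lev k b v].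

(* Ordered decompositions of v as a sum of elements of l: an element used k    *)
(* times occupies k of the head v places.                                      *)
Fixpoint tuples (l : seq (seq bool)) (v : seq nat) : nat :=
  if l is b :: l' then
    sumn [seq 'C(head 0%N v, k) * tuples l' (subv k b v)
            | k <- levels b v]%N
  else all (pred1 0%N) v.

Lemma lev_map k xi f :
  lev k (vec xi) (map f ps) = all (fun x => k * box xi x <= f x)%N ps.
Proof.
rewrite /lev /vec; elim: ps => //= x s ->; congr (_ && _).
by case: (box xi x); rewrite ?muln1 ?muln0.
Qed.

Lemma subv_map k xi f :
  subv k (vec xi) (map f ps) = [seq f x - k * box xi x | x <- ps]%N.
Proof.
rewrite /subv /vec; elim: ps => //= x s ->; congr (_ :: _).
by case: (box xi x); rewrite ?muln1 ?muln0 ?subn0.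
Qed.

Hypothesis corner : (0, 0, 0)%N \in ps.

(** Every member of [l] contains the corner, so a multiplicity never exceeds the corner value of
    [f], and the bounded search misses nothing. *)
Lemma mem_families (l : seq array2) (f : pos -> nat) (m : plane_family) :
  uniq l -> all (box^~ (0, 0, 0)%N) l ->
  m \in families l f <->
  (forall z, z \notin l -> m z = 0%N) /\
  (forall x, x \in ps -> f x = \sum_(z <- l) m z * box z x)%N.
Proof.
elim: l f m => [|xi l ih] f m /=.
  move=> _ _; case: ifPn => [/allP f0|/allPn[x xs fx]].
    rewrite inE; split=> [/eqP ->|[m0 _]].
      by split=> [z _|x /f0 /eqP ->]; rewrite ?fsfunE ?big_nil.
    by apply/eqP/fsfunP => z; rewrite m0 // fsfunE.
  by split=> // -[_ /(_ x xs) e]; rewrite e big_nil eqxx in fx.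
move=> /andP[xil ul] /andP[bxi bl].
split=> [/allpairsPdep[k [m' [kin m'in ->]]]|[m0 mf]].
  move: kin; rewrite mem_multiplicities => /andP[_ /allP kf].
  have [m'0 m'f] := (ih _ _ ul bl).1 m'in.
  split=> [z|x xs].
    rewrite inE negb_or updE => /andP[/negPf -> /m'0 //].
  rewrite big_cons updE eqxx.
  rewrite (eq_big_seq (fun z => m' z * box z x)%N); last first.
    by move=> z zl; rewrite updE; case: eqP zl xil => // -> ->.
  by rewrite -m'f // subnKC // kf.
have xi_le x : x \in ps -> (m xi * box xi x <= f x)%N.
  by move=> xs; rewrite mf // big_cons leq_addr.
(* The family is cut into its value at [xi] and the same family with that value erased, which is
   supported on the rest of the list. *)
apply/allpairsPdep; exists (m xi), (upd m xi 0); split.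
- rewrite mem_multiplicities; have := xi_le _ corner.
  by rewrite bxi muln1 => ->; apply/allP.
- apply/ih => //; split=> [z zl|x xs].
    rewrite updE; case: eqP => // /eqP zxi.
    by rewrite m0 // inE negb_or zxi.
  rewrite mf // big_cons addKn; apply: eq_big_seq => z zl.
  by rewrite updE; case: eqP zl xil => // -> ->.
- by apply/fsfunP => z; rewrite !updE; case: eqP => // ->.
Qed.

Lemma families_out (l : seq array2) (f : pos -> nat) (m : plane_family) z :
  uniq l -> all (box^~ (0, 0, 0)%N) l ->
  m \in families l f -> z \notin l -> m z = 0%N.
Proof. by move=> ul bl /(mem_families _ _ ul bl)[+ _]; exact. Qed.

Lemma uniq_families (l : seq array2) (f : pos -> nat) : uniq l -> all (box^~ (0, 0, 0)%N) l ->
  uniq (families l f).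
Proof.
elim: l f => [|xi l ih] f /=; first by case: ifP.
move=> /andP[xil ul] /andP[bxi bl]; apply: allpairs_uniq_dep.
- by rewrite filter_uniq ?iota_uniq //.
- by move=> k _; exact: ih.
move=> p q /allpairsPdep[k [m [_ mi ->]]] /allpairsPdep[k' [m' [_ mi' ->]]] /= e.
have ek : k = k' by have := congr1 (fun h : plane_family => h xi) e; rewrite !updE eqxx.
rewrite ek; congr Tagged; apply/fsfunP => z.
have [->|zxi] := eqVneq z xi.
  by rewrite (families_out ul bl mi) // (families_out ul bl mi').
have := congr1 (fun h : plane_family => h z) e.
by rewrite !updE (negPf zxi).
Qed.

(** With $h$ the corner value, $\binom{h}{k}/h!=1/(k!\,(h-k)!)$: taking one plane partition $k$
    times fills $k$ of $h$ places and leaves $h-k$. Iterating turns the products of $1/m!$ into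
    multinomial coefficients. The corner has to come first in [ps] because [tuples] reads $h$ off
    the head. *)
Lemma sum_families (l : seq array2) (f : pos -> nat) : uniq l -> all (box^~ (0, 0, 0)%N) l ->
    head (0, 0, 0)%N ps = (0, 0, 0)%N ->
  \sum_(m <- families l f) \prod_(z <- l) ((m z)`!%:R)^-1 =
  (tuples (map vec l) (map f ps))%:R / (f (0, 0, 0)%N)`!%:R :> rat.
Proof.
move=> + + hd; have hdf (g : pos -> nat) : head 0%N (map g ps) = g (0, 0, 0)%N.
  by case: ps hd corner => //= x s ->.
elim: l f => [|xi l ih] f.
  move=> _ _; rewrite /= (_ : all _ (map f ps) = all (fun x => f x == 0%N) ps);
    last by rewrite all_map.
  case: allP => [f0|nf]; last by rewrite big_nil mul0r.
  by rewrite big_seq1 big_nil (eqP (f0 _ corner)) fact0 divr1.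
move=> /= /andP[xil ul] /andP[bxi bl].
rewrite big_allpairs_dep /=.
transitivity (\sum_(k <- multiplicities xi f)
   (k`!%:R)^-1 * ((tuples (map vec l) [seq f x - k * box xi x | x <- ps]%N)%:R
                  / (f (0, 0, 0) - k)`!%:R) : rat).
  rewrite big_seq [RHS]big_seq; apply: eq_bigr => k kin.
  have -> : (f (0, 0, 0) - k = f (0, 0, 0) - k * box xi (0, 0, 0))%N.
    by rewrite bxi muln1.
  rewrite -ih //.
  rewrite mulr_sumr big_seq [RHS]big_seq; apply: eq_bigr => m mi.
  rewrite big_cons updE eqxx; congr (_ * _); apply: eq_big_seq => z zl.
  by rewrite updE; case: eqP zl xil => // -> ->.
rewrite sumnE big_map hdf natr_sum mulr_suml.
have -> : levels (vec xi) (map f ps) = multiplicities xi f.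
  by rewrite /levels hdf; apply: eq_filter => k; rewrite lev_map.
apply: eq_big_seq => k; rewrite mem_multiplicities => /andP[kf _].
rewrite subv_map natrM -(bin_fact kf) !natrM !invfM.
have nz n : n`!%:R != 0 :> rat by rewrite pnatr_eq0 -lt0n fact_gt0.
have bnz : 'C(f (0, 0, 0)%N, k)%:R != 0 :> rat by rewrite pnatr_eq0 -lt0n bin_gt0.
have k0 := nz k; have fk0 := nz (f (0, 0, 0) - k)%N.
by field; rewrite bnz k0 fk0.
Qed.
End Families.

Definition preds (x : pos) : seq pos := let: (i, j, k) := x in
  (if i is i'.+1 then [:: (i', j, k)] else [::]) ++
  (if j is j'.+1 then [:: (i, j', k)] else [::]) ++
  (if k is k'.+1 then [:: (i, j, k')] else [::]).

Fixpoint allbits (n : nat) : seq (seq bool) :=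
  if n is n'.+1 then
    let s := allbits n' in map (cons true) s ++ map (cons false) s
  else [:: [::]].

Lemma mem_allbits n b : (b \in allbits n) = (size b == n).
Proof.
have inj (c : bool) : injective (cons c) by move=> x y [].
elim: n b => [|n ih] [|[] b] //=; rewrite mem_cat.
- by apply/negP => /orP[] /mapP[].
- rewrite (mem_map (inj _)) ih eqSS; case: (_ == n) => //=.
  by apply/negP => /mapP[].
- rewrite orbC (mem_map (inj _)) ih eqSS.
  by case: (_ == n) => //=; apply/negP => /mapP[].
Qed.

Lemma allbits_uniq n : uniq (allbits n).
Proof.
elim: n => //= n ih; rewrite cat_uniq !map_inj_uniq ?ih //=; try by move=> x y [].
by rewrite andbT; apply/hasPn => b /mapP[c _ ->]; apply/negP => /mapP[].
Qed.

Lemma plane_corner (xi : array2) :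
  is_plane xi -> xi <> [fsfun] -> box xi (0, 0, 0)%N.
Proof.
move=> pxi xi0; apply/negPn/negP => nb; apply: xi0; apply/fsfunP => -[i j].
have x00 : xi (0, 0)%N = 0%N by apply/eqP; rewrite -leqn0 leqNgt.
have le0 : (xi (i, j) <= xi (0, 0))%N.
  apply: (@leq_trans (xi (0%N, j))).
    by elim: i => // i; apply: leq_trans; case: (pxi i j).
  by elim: j => // j; apply: leq_trans; case: (pxi 0%N j).
by apply/eqP; rewrite fsfunE -leqn0 (leq_trans le0) // x00.
Qed.

Section Downsets.
Variable ps : seq pos.

Definition bit (b : seq bool) (x : pos) : bool := nth false b (index x ps).

Definition isdown (b : seq bool) : bool :=
  all (fun x => bit b x ==> all (bit b) (preds x)) ps.

Definition dsets : seq (seq bool) :=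
  [seq b <- allbits (size ps) | isdown b && bit b (0, 0, 0)%N].

(** The column height is the first missing level. If no level in the search range is missing, [find]
    returns the length of the range, which is then the right height. *)
Definition xi_of (b : seq bool) : array2 :=
  [fsfun x in [fset y in map fst ps]%fset =>
     find (fun k => ~~ bit b (x, k)) (iota 0 (\max_(y <- ps) y.2).+1)].

Lemma bit_in b x : (size b <= size ps)%N -> bit b x -> x \in ps.
Proof.
by move=> sb; apply: contraTT => xs; rewrite /bit memNindex // nth_default.
Qed.

Lemma isdownP b x y : (size b <= size ps)%N -> isdown b -> y \in preds x ->
  bit b x -> bit b y.
Proof.
move=> sb /allP db yx bx; have /implyP := db _ (bit_in sb bx).
by move=> /(_ bx) /allP; exact.
Qed.

Lemma isdown_le b i j k k' : (size b <= size ps)%N -> isdown b ->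
  (k' <= k)%N -> bit b (i, j, k) -> bit b (i, j, k').
Proof.
move=> sb db /subnKC <-; elim: (k - k')%N => [|n ih]; first by rewrite addn0.
rewrite addnS => bk; apply: ih; apply: isdownP bk => //.
by rewrite /= !mem_cat inE eqxx !orbT.
Qed.

Lemma box_xi_of b x : (size b <= size ps)%N -> isdown b ->
  box (xi_of b) x = bit b x.
Proof.
case: x => [[i j] k] sb db; rewrite /box /box_in /= fsfunE !inE.
case: ifPn => [_|nin]; last first.
  apply/esym/negP => /(bit_in sb) xs; case/negP: nin.
  by apply/mapP; exists (i, j, k).
set N := (\max_(y <- ps) y.2).+1; set p := fun k => _.
apply/idP/idP => [kf|bk].
  have kN : (k < N)%N.
    by apply: leq_trans kf _; have := find_size p (iota 0 N); rewrite size_iota.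
  by have := before_find 0%N kf; rewrite nth_iota // add0n => /negbFE.
have kN : (k < N)%N.
  by rewrite ltnS /N; exact: (leq_bigmax_seq (P := xpredT) (F := snd) _ (bit_in sb bk)).
rewrite ltnNge; apply/negP => fk.
have hp : has p (iota 0 N).
  by rewrite has_find size_iota; exact: leq_ltn_trans fk kN.
have := nth_find 0%N hp; rewrite nth_iota ?add0n; last first.
  exact: leq_ltn_trans fk kN.
by rewrite /p (isdown_le sb db fk bk).
Qed.

Lemma array2_ext (xi xi' : array2) : box xi =1 box xi' -> xi = xi'.
Proof.
move=> e; apply/fsfunP => -[i j]; apply/eqP; rewrite eqn_leq.
apply/andP; split; rewrite leqNgt; apply/negP => lt.
  by have := e (i, j, xi' (i, j)); rewrite /box /box_in /= lt ltnn.
by have := e (i, j, xi (i, j)); rewrite /box /box_in /= lt ltnn.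
Qed.

Hypothesis ups : uniq ps.

Lemma vec_xi_of b : b \in dsets -> vec ps (xi_of b) = b.
Proof.
rewrite mem_filter mem_allbits => /andP[/andP[db _] /eqP sb].
apply: (@eq_from_nth _ false); rewrite size_map // => n np.
rewrite (nth_map (0, 0, 0)%N) // box_xi_of ?sb //.
by rewrite /bit index_uniq.
Qed.

Definition planes : seq array2 := map xi_of dsets.

Lemma uniq_planes : uniq planes.
Proof.
rewrite map_inj_in_uniq ?filter_uniq ?allbits_uniq // => b c bd cd e.
by rewrite -(vec_xi_of bd) e vec_xi_of.
Qed.

Lemma map_vec_planes : map (vec ps) planes = dsets.
Proof.
rewrite /planes -map_comp -[RHS]map_id; apply/eq_in_map => b bd.
exact: vec_xi_of.
Qed.

(** Reduces the quantification over all plane partitions to finitely many bit vectors: downsets of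
    [ps] that contain the corner. *)
Lemma mem_planes xi : xi \in planes <->
  [/\ is_plane xi, xi <> [fsfun] & forall x, box xi x -> x \in ps].
Proof.
split=> [/mapP[b]|[pxi xi0 xs]].
  rewrite mem_filter mem_allbits => /andP[/andP[db b0] /eqP sb ->].
  have le : (size b <= size ps)%N by rewrite sb.
  have bE := box_xi_of _ le db.
  (* If the first column were longer, it would have a box at height [xi_of b (i', j')], and closure
     would put that box over [(i', j')] as well. *)
  have mono i j i' j' :
      (forall k, (i', j', k) \in preds (i, j, k)) ->
      (xi_of b (i, j) <= xi_of b (i', j'))%N.
    move=> h; rewrite leqNgt; apply/negP => lt.
    have : box (xi_of b) (i, j, xi_of b (i', j')) by [].
    rewrite bE => /(isdownP le db (h _)); rewrite -bE.
    by rewrite /box /box_in ltnn.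
  split=> [i j||x].
  - by split; apply: mono => k; rewrite /= ?mem_cat !inE eqxx ?orbT.
  - by move=> e; move: b0; rewrite -bE e /box /box_in fsfunE.
  - by rewrite bE; exact: bit_in.
pose b := vec ps xi.
have bE x : bit b x = box xi x.
  rewrite /bit /b /vec; have [xin|xnin] := boolP (x \in ps).
    by rewrite (nth_map x) ?index_mem // nth_index.
  rewrite nth_default ?size_map ?memNindex //.
  by apply/esym; apply: contraNF xnin => /xs.
have sb : size b = size ps by rewrite size_map.
have k_mono i j k : box xi (i, j, k.+1) -> box xi (i, j, k).
  by rewrite /box /box_in; exact: ltnW.
have db : isdown b.
  apply/allP => x _; apply/implyP; rewrite bE => bx; apply/allP => y yx; rewrite bE.
  case: x bx yx => [[i j] k] bx; rewrite /= !mem_cat => /or3P[].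
  - case: i bx => // i bx; rewrite inE => /eqP ->.
    by apply: leq_trans bx _; case: (pxi i j).
  - case: j bx => // j bx; rewrite inE => /eqP ->.
    by apply: leq_trans bx _; case: (pxi i j).
  - by case: k bx => // k bx; rewrite inE => /eqP ->; exact: k_mono.
have b0 := plane_corner pxi xi0.
apply/mapP; exists b.
  by rewrite mem_filter mem_allbits sb eqxx db bE b0.
by apply: array2_ext => x; rewrite box_xi_of ?sb // bE.
Qed.

End Downsets.

Lemma big_finsupp (T : Type) (idx : T) (op : Monoid.com_law idx)
    (m : plane_family) (l : seq array2) (F : array2 -> T) : uniq l ->
  (forall z, z \notin l -> m z = 0%N) -> (forall z, m z = 0%N -> F z = idx) ->
  \big[op/idx]_(z <- finsupp m) F z = \big[op/idx]_(z <- l) F z.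
Proof.
move=> ul m0 F0.
have p : perm_eq (finsupp m) [seq z <- l | m z != 0%N].
  apply: uniq_perm; rewrite ?fset_uniq ?filter_uniq // => z.
  rewrite mem_finsupp mem_filter; case: eqP => //= mz.
  by apply/esym/negPn/negP => /m0.
rewrite (perm_big _ p) big_filter big_mkcond; apply: eq_bigr => z _.
by case: eqP => //= /F0.
Qed.

(** A plane partition of positive multiplicity contributes to the sum at each of its boxes, so it
    lies inside the support of the solid partition. *)
Lemma Cpi_arr s : wf s -> (0, 0, 0)%N \in keys s ->
  Cpi (arr s) = [set` families (keys s) (planes (keys s)) (lookup s)]%classic.
Proof.
move=> ws cor; case/andP: (ws) => us nzs.
have ul := uniq_planes us; have lP := @mem_planes (keys s).
(* An opaque name for the list, which keeps it from being unfolded. *)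
have [l lE] : {l | l = planes (keys s)} by exists (planes (keys s)).
rewrite -lE in ul lP *.
have bl : all (box^~ (0, 0, 0)%N) l.
  apply/allP => z; rewrite lE => /mapP[b bd ->].
  move: (bd); rewrite mem_filter mem_allbits => /andP[/andP[db b0] /eqP sb].
  by rewrite box_xi_of // sb.
apply/seteqP; split=> m /=.
  move=> [mp mf].
  have m0 z : z \notin l -> m z = 0%N.
    apply: contraNeq => mz; have [pz z0] := mp z mz.
    apply/lP; split=> // -[[i j] k] bz.
    rewrite -lookup_neq0 // -arrE mf -lt0n.
    have zin : z \in finsupp m by rewrite mem_finsupp.
    rewrite (bigD1_seq z) ?fset_uniq //= addn_gt0 muln_gt0 lt0n mz /=.
    by rewrite /box /= in bz; rewrite bz.
  apply/mem_families => //; split=> // -[[i j] k] _.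
  by rewrite -arrE mf; apply: big_finsupp => // z ->.
move=> /(mem_families cor _ _ ul bl)[m0 mf]; split=> [z mz|i j k].
  have : z \in l by apply: contraNT mz => /m0 ->.
  by case/lP.
transitivity (\sum_(z <- l) m z * box z (i, j, k))%N; last first.
  by apply/esym; apply: big_finsupp => // z ->.
have [xs|xs] := boolP ((i, j, k) \in keys s); first by rewrite -mf // arrE.
rewrite arrE lookup_out // big_seq big1 // => z /lP[_ _ zs].
case bz: (box z _); last by rewrite muln0.
by rewrite zs in xs.
Qed.

Lemma omega_cE s : wf s -> head (0, 0, 0)%N (keys s) = (0, 0, 0)%N ->
  omega_c (arr s) =
    (tuples (dsets (keys s)) (map snd s))%:R / (head 0%N (map snd s))`!%:R.
Proof.
move=> ws hd; rewrite /omega_c; case: eqP => [e|ne].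
  (* Empty partition: no bit vector of length 0 contains the corner, so the formula reads $1/0!$, in
     agreement with the convention. *)
  have : keys s = [::].
    apply/nilP; rewrite /nilp -(perm_size (finsupp_arr ws)) e.
    by rewrite finsupp0.
  by case: s {ws hd e} => //= _; rewrite divr1.
have cor : (0, 0, 0)%N \in keys s.
  case: s ws hd ne => [|[x v] s] /= _; last by move=> -> _; rewrite inE eqxx.
  by move=> _ []; apply/fsfunP => x; rewrite arrE fsfunE.
case/andP: (ws) => us _.
have ul := uniq_planes us.
have bl : all (box^~ (0, 0, 0)%N) (planes (keys s)).
  apply/allP => z /mapP[b bd ->].
  move: (bd); rewrite mem_filter mem_allbits => /andP[/andP[db b0] /eqP sb].
  by rewrite box_xi_of // sb.
rewrite Cpi_arr // -fsbig_seq ?uniq_families //.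
rewrite (eq_big_seq (fun m : plane_family =>
    \prod_(z <- planes (keys s)) ((m z)`!%:R)^-1)); last first.
  move=> m min; apply: big_finsupp => // z; last by move=> ->; rewrite invr1.
  exact: families_out min.
rewrite sum_families // map_vec_planes //.
have -> : map (lookup s) (keys s) = map snd s.
  by rewrite -[in RHS](map_lookup us) -map_comp.
congr (_ / _`!%:R).
by case: s hd cor {us ul bl ne ws} => // -[x v] s /= ->; rewrite eqxx.
Qed.

(** * Enumeration of solid partitions *)

(** Binary numbers, because these products are far too large for unary evaluation. *)
Definition Nprod (l : seq nat) : BinNums.N :=
  foldr (fun n a => BinNat.N.mul (bin_of_nat n) a) (bin_of_nat 1) l.

Lemma NprodE l : nat_of_bin (Nprod l) = (\prod_(n <- l) n)%N.
Proof.
elim: l => [|n l ih]; first by rewrite big_nil.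
rewrite big_cons -ih -[n in RHS]bin_of_natK [Nprod _]/=.
by case: (bin_of_nat n) (Nprod l) => [|p] [|q] //=; rewrite ?muln0 ?nat_of_mul_pos.
Qed.

Lemma prod_iota_fact n : (\prod_(i <- iota 1 n) i = n`!)%N.
Proof. by rewrite fact_prod /index_iota subSS subn0. Qed.

Definition nonzero (l : seq nat) := [seq n <- l | n != 0%N].

Definition height (s : seq nb) : nat := head 0%N (map snd s).

Definition ntuples (s : seq nb) : nat := tuples (dsets (keys s)) (map snd s).

(** After well-formedness: the corner is the only position on the main diagonal, $c_0=0$, and the
    equality of $|\omega|=\prod N/\prod P$ with $\omega^c$, the quotient of [ntuples s] by $h!$,
    cross-multiplied. *)
Definition check (s : seq nb) : bool :=
  let B := cboxes s in
  let P := pmap dval (pos_pairs B) in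
  let N := pmap dval (neg_pairs B) in
  [&& wf s, head (0, 0, 0)%N (keys s) == (0, 0, 0)%N,
      all (fun x => (x.1.1 == x.1.2) && (x.1.2 == x.2) ==> (x == (0, 0, 0)%N)) (keys s),
      count (pred1 0%N) P == count (pred1 0%N) N
    & Nprod (ntuples s :: nonzero P) == Nprod (iota 1 (height s) ++ nonzero N)].

Lemma check_omega s w : check s -> is_wpi (arr s) w ->
  exists2 om : rat, is_omega (arr s) w om & `|om| = omega_c (arr s).
Proof.
case/and5P => ws /eqP hd /allP dg /eqP cnt /eqP pr wpi.
have dg0 i : arr s (i.+1, i.+1, i.+1) = 0%N.
  rewrite arrE lookup_out //; apply/negP => /dg /=.
  by rewrite !eqxx.
have [om h e] := omega_pairs (boxes_arr ws) cnt dg0 wpi.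
exists om => //; rewrite e omega_cE // -/(ntuples s) -/(height s).
move: pr => /(congr1 nat_of_bin); rewrite !NprodE big_cons big_cat /=.
rewrite !big_filter -!/(prodnz _).
rewrite prod_iota_fact.
move=> pr; apply/eqP; rewrite eqr_div ?pnatr_eq0 -?lt0n ?fact_gt0 ?prodnz_gt0 //.
by rewrite -!natrM eqr_nat pr mulnC.
Qed.

(** Each letter word is a monomial in $t_1,t_2,t_3$ ([o] is 1), and the number beside it is the
    height of its column in the $t_4$ direction. *)
Definition listed : seq (seq nb) :=
  let: (o, a, aa, b, bb, ab, bc, c) :=
    ((0, 0, 0), (1, 0, 0), (2, 0, 0), (0, 1, 0), (0, 2, 0), (1, 1, 0), (0, 1, 1), (0, 0, 1))%N in
  [:: [:: (o, 3); (a, 1); (b, 1); (ab, 1); (c, 1)];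
      [:: (o, 3); (a, 2); (b, 1); (ab, 1); (c, 1)];
      [:: (o, 3); (a, 2); (aa, 1); (b, 1); (ab, 1); (c, 1)];
      [:: (o, 3); (a, 2); (aa, 1); (b, 1); (ab, 1); (bc, 1); (c, 1)];
      [:: (o, 3); (a, 2); (aa, 1); (b, 2); (ab, 1); (bc, 1); (c, 1)];
      [:: (o, 4); (a, 2); (aa, 1); (b, 2); (ab, 1); (bc, 1); (c, 1)];
      [:: (o, 5); (a, 2); (aa, 1); (b, 2); (ab, 1); (bc, 1); (c, 1)];
      [:: (o, 6); (a, 2); (aa, 1); (b, 2); (ab, 1); (bc, 1); (c, 1)];
      [:: (o, 6); (a, 2); (aa, 1); (b, 2); (bb, 1); (ab, 1); (bc, 1); (c, 1)]]%N.

Definition bound (x : pos) (rem : nat) (acc : seq nb) : nat :=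
  foldr minn rem (map (lookup acc) (preds x)).

(** Each new entry is bounded by the size still available and by the predecessors already chosen.
    Zero entries are not recorded, so the lists come out in the form of [canon]. *)
Fixpoint enum_from (todo : seq pos)
    (acc : seq nb) (rem : nat) : seq (seq nb) :=
  if todo is x :: todo' then
    flatten [seq enum_from todo' (if v == 0%N then acc else rcons acc (x, v))
                   (rem - v)%N
      | v <- iota 0 (bound x rem acc).+1]
  else [:: acc].

Lemma enum_from_cons x todo acc rem : enum_from (x :: todo) acc rem =
  flatten [seq enum_from todo (if v == 0%N then acc else rcons acc (x, v)) (rem - v)%N
             | v <- iota 0 (bound x rem acc).+1].
Proof. by []. Qed.

Definition cube (n : nat) : seq pos :=
  [seq (ij, k) | ij <- [seq (i, j) | i <- iota 0 n, j <- iota 0 n], k <- iota 0 n].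

Definition axis (n : nat) : seq pos := [seq (0, 0, k)%N | k <- iota 0 n].

Definition canon (f : pos -> nat) (ps : seq pos) : seq nb :=
  [seq p <- [seq (x, f x) | x <- ps] | p.2 != 0%N].

Lemma canon_rcons f ps x : canon f (rcons ps x) =
  if f x == 0%N then canon f ps else rcons (canon f ps) (x, f x).
Proof. by rewrite /canon map_rcons filter_rcons /=; case: (f x == 0%N). Qed.

Lemma lookup_canon f ps x : lookup (canon f ps) x = if x \in ps then f x else 0%N.
Proof.
elim: ps => //= y ps ih; rewrite inE eq_sym /canon /=.
have [fy|fy] := eqVneq (f y) 0%N; rewrite /= -/(canon f ps) ih.
  by case: eqP => // <-; rewrite fy; case: ifP.
by case: eqP => // ->.
Qed.

Fixpoint ordered (pre todo : seq pos) : bool :=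
  if todo is x :: todo' then
    all (fun y => y \in pre) (preds x) && ordered (rcons pre x) todo'
  else true.

Lemma leq_foldr_minn n r (l : seq nat) :
  (n <= foldr minn r l)%N = (n <= r)%N && all (fun m => n <= m)%N l.
Proof. by elim: l => [|m l ih] /=; rewrite ?andbT // leq_min ih andbCA. Qed.

Lemma solid_preds (pi : array3) x y : is_solid pi -> y \in preds x ->
  (pi x <= pi y)%N.
Proof.
case: x => [[i j] k] sol; rewrite /= !mem_cat => /or3P[].
- by case: i => // i; rewrite inE => /eqP ->; case: (sol i j k).
- by case: j => // j; rewrite inE => /eqP ->; case: (sol i j k).
- by case: k => // k; rewrite inE => /eqP ->; case: (sol i j k).
Qed.

(** At every position the branch [v = pi x] is followed. [ordered] guarantees that the predecessors
    of [x] already carry their final values when the bound is taken. *)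
Lemma mem_enum_from (pi : array3) pre todo rem : is_solid pi ->
  ordered pre todo -> (\sum_(x <- todo) pi x <= rem)%N ->
  canon pi (pre ++ todo) \in enum_from todo (canon pi pre) rem.
Proof.
move=> sol; elim: todo pre rem => [|x todo ih] pre rem.
  by rewrite cats0 inE.
rewrite enum_from_cons big_cons => /andP[/allP xpre ord] le.
apply/flattenP; exists (enum_from todo (canon pi (rcons pre x)) (rem - pi x)).
  apply/mapP; exists (pi x); last by rewrite canon_rcons.
  rewrite mem_iota add0n ltnS leq_foldr_minn (leq_trans (leq_addr _ _) le) /=.
  rewrite all_map; apply/allP => y yx /=.
  by rewrite lookup_canon xpre // solid_preds.
by rewrite -cat_rcons; apply: ih => //; rewrite leq_subRL ?(leq_trans (leq_addr _ _) le).
Qed.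

Lemma arr_canon (pi : array3) ps : (forall x, pi x != 0%N -> x \in ps) ->
  arr (canon pi ps) = pi.
Proof.
move=> sup; apply/fsfunP => x; rewrite arrE lookup_canon.
by case: ifPn => // /(contraNN (sup x)) /negPn /eqP.
Qed.

Lemma sum_psize (pi : array3) ps : uniq ps -> (forall x, pi x != 0%N -> x \in ps) ->
  (\sum_(x <- ps) pi x = psize pi)%N.
Proof.
move=> ups sup; rewrite /psize.
have p : perm_eq (finsupp pi) [seq x <- ps | pi x != 0%N].
  apply: uniq_perm; rewrite ?fset_uniq ?filter_uniq // => x.
  rewrite mem_finsupp mem_filter; case: (boolP (pi x != 0%N)) => //= /sup ->.
  by [].
rewrite (perm_big _ p) big_filter [RHS]big_mkcond; apply: eq_bigr => x _.
by case: eqP.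
Qed.

Lemma mem_solid_enum (pi : array3) ps n : is_solid pi -> uniq ps -> ordered [::] ps ->
  (forall x, pi x != 0%N -> x \in ps) -> (psize pi <= n)%N ->
  canon pi ps \in enum_from ps [::] n.
Proof.
move=> sol ups ord sup le.
by apply: (@mem_enum_from pi [::]) => //; rewrite sum_psize.
Qed.

Lemma size_psize (pi : array3) (U : seq pos) : uniq U ->
  (forall x, x \in U -> pi x != 0%N) -> (size U <= psize pi)%N.
Proof.
move=> uU U0; apply: leq_trans (uniq_leq_size uU (s2 := finsupp pi) _) _.
  by move=> x /U0; rewrite mem_finsupp.
rewrite -sum1_size /psize big_seq [X in (_ <= X)%N]big_seq.
by apply: leq_sum => x; rewrite mem_finsupp lt0n.
Qed.

Lemma solid_bound (pi : array3) i j k n : is_solid pi -> (psize pi <= n)%N ->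
  pi (i, j, k) != 0%N -> [/\ i < n, j < n & k < n]%N.
Proof.
(* Along a coordinate line all positions up to a nonzero entry are nonzero, so their number is at
   most the size. *)
move=> sol le; have mono (g : nat -> pos) m :
    injective g -> (forall a, pi (g a.+1) <= pi (g a))%N ->
    pi (g m) != 0%N -> (m < n)%N.
  move=> ginj gle gm; apply: leq_trans le.
  rewrite -[m.+1](size_iota 0) -(size_map g); apply: size_psize.
    by rewrite map_inj_uniq ?iota_uniq.
  move=> x /mapP[a]; rewrite mem_iota add0n ltnS => /andP[_ am] ->.
  rewrite -lt0n (@leq_trans (pi (g m))) ?lt0n //.
  rewrite -(subnKC am); elim: (m - a)%N => [|d ih]; first by rewrite addn0.
  by rewrite addnS; apply: leq_trans ih.
move=> p0; split.
- by apply: (mono (fun a => (a, j, k))) p0 => [a b []|a] //; case: (sol a j k).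
- by apply: (mono (fun a => (i, a, k))) p0 => [a b []|a] //; case: (sol i a k).
- by apply: (mono (fun a => (i, j, a))) p0 => [a b []|a] //; case: (sol i j a).
Qed.

Lemma mem_cube n i j k : (i, j, k) \in cube n = [&& i < n, j < n & k < n]%N.
Proof.
rewrite /cube; apply/allpairsP/and3P => /= [[[ij k'] [/= + kn [e ->]]]|[i_n jn kn]].
  rewrite -{}e => /allpairsP[[a b] [/= an bn [-> ->]]].
  by move: an bn kn; rewrite !mem_iota.
exists (i, j, k); rewrite !mem_iota; split=> //.
by apply/allpairsP; exists (i, j); rewrite !mem_iota.
Qed.

Definition solidb (s : seq nb) : bool :=
  all (fun x => all (fun y => lookup s x <= lookup s y)%N (preds x)) (keys s).

Lemma solidbP s : solidb s -> is_solid (arr s).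
Proof.
move=> /allP sol.
have le x y : y \in preds x -> (arr s x <= arr s y)%N.
  rewrite !arrE; have [/sol /allP h /h //|xs _] := boolP (x \in keys s).
  by rewrite lookup_out.
by move=> i j k; split; apply: le; rewrite /= ?mem_cat !inE eqxx ?orbT.
Qed.

Definition solids6 : seq (seq nb) := enum_from (cube 6) [::] 6.

(** The last condition makes each list recoverable from its array, so that different lists give
    different partitions and no term is counted twice in the generating series. *)
Lemma solids6_check : all (fun s => [&& check s, solidb s,
  sumn (map snd s) <= 6 & s == canon (lookup s) (cube 6)]%N) solids6 && uniq solids6.
Proof. by vm_cast_no_check (erefl true). Qed.

Lemma cube6_ordered : ordered [::] (cube 6) && uniq (cube 6).
Proof. by vm_cast_no_check (erefl true). Qed.

Lemma solids6P (pi : array3) : is_solid pi -> (psize pi <= 6)%N ->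
  exists2 s, s \in solids6 & pi = arr s.
Proof.
move=> sol le; have /andP[ord uc] := cube6_ordered.
have sup x : pi x != 0%N -> x \in cube 6.
  by case: x => [[i j] k] /(solid_bound sol le) /and3P; rewrite mem_cube.
exists (canon pi (cube 6)); first exact: mem_solid_enum.
by rewrite arr_canon.
Qed.

(** * Partitions supported on one axis *)

Definition leaps (s : seq nb) (n : nat) : seq nat :=
  [seq (lookup s (0, 0, k) - lookup s (0, 0, k.+1))%N | k <- iota 0 n].

Definition columns10 : seq (seq nb) := enum_from (axis 10) [::] 10.
Arguments columns10 : simpl never.

(** The plane partitions inside a column are its initial segments, so the decomposition is unique,
    with the leaps as multiplicities, and the number of ordered tuples is the multinomial
    coefficient of the leaps. *)
Lemma columns10_check : all (fun s => check s &&
  (Nprod (ntuples s :: flatten [seq iota 1 d | d <- leaps s 10])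
     == Nprod (iota 1 (height s)))) columns10.
Proof. by vm_cast_no_check (erefl true). Qed.

Lemma axis10_ordered : ordered [::] (axis 10) && uniq (axis 10).
Proof. by []. Qed.

Lemma omega_column (pi : array3) (w : K) : is_solid pi ->
  (forall i j k : nat, pi (i, j, k) <> 0%N -> i = 0%N /\ j = 0%N) ->
  (psize pi <= 10)%N -> is_wpi pi w ->
  exists2 om : rat, is_omega pi w om & `|om| = omega_c pi /\
    omega_c pi = \big[*%R/1]_(k \in [set: nat])
      ((((pi (0, 0, k) - pi (0, 0, k.+1))`!)%N%:R)^-1 : rat).
Proof.
move=> sol sup le wpi; have /andP[ord uc] := axis10_ordered.
have insup x : pi x != 0%N -> x \in axis 10.
  case: x => [[i j] k] p0; have [-> ->] := sup i j k (elimN eqP p0).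
  have [_ _ k10] := solid_bound sol le p0.
  by apply/mapP; exists k; rewrite // mem_iota.
have := mem_solid_enum sol uc ord insup le; have := arr_canon insup.
move: (canon _ _) => s sE sin; rewrite -{}sE in insup wpi *.
have /allP/(_ s sin)/andP[chk /eqP prE] := columns10_check.
have [om h e] := check_omega chk wpi; exists om => //; split=> //.
case/and5P: chk => ws /eqP hd _ _ _.
have leap0 k : k \notin iota 0 10 -> arr s (0, 0, k)%N = 0%N.
  apply: contraNeq => /insup /mapP[k' kin [->]].
  by [].
(* From index 10 on the entries vanish, hence so do the leaps, and the remaining factors are
   $1/0!=1$. *)
rewrite omega_cE // (fsbigE (iota 0 10)) ?iota_uniq //; last first.
  by move=> k _ /leap0 ->; rewrite sub0n fact0 invr1.
move: prE => /(congr1 nat_of_bin); rewrite !NprodE big_cons prod_iota_fact.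
rewrite big_flatten big_map -/(ntuples s) -/(height s) => prE.
have T0 : ntuples s != 0%N.
  by apply: contraTneq (fact_gt0 (height s)) => T0; rewrite -prE T0.
rewrite -prE.
rewrite /leaps big_map natrM invfM mulrA divff ?mul1r ?pnatr_eq0 //.
rewrite natr_prod -prodfV [RHS]big_mkcond; apply: eq_bigr => k _.
by rewrite in_setT prod_iota_fact !arrE.
Qed.

(** * Partitions given by their polynomial $Z_\pi$ *)

Lemma boxes_uniq pi : uniq (boxes pi).
Proof.
apply: allpairs_uniq_dep => [|x _|p q]; rewrite ?fset_uniq ?iota_uniq //.
move=> /allpairsPdep[x [l [_ _ ->]]] /allpairsPdep[y [l' [_ _ ->]]] /=.
by case: x y => [[i j] k] [[i' j'] k'] /= [-> -> -> ->].
Qed.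

Lemma mem_boxes pi x l : (emb (x, l) \in boxes pi) = (l < pi x)%N.
Proof.
apply/idP/idP => [/allpairsPdep[y [l' [_ + e]]]|lx].
  rewrite mem_iota add0n; case: x y e => [[i j] k] [[i' j'] k'] /=.
  by case=> -> -> -> ->.
apply/allpairsPdep; exists x, l; rewrite mem_finsupp mem_iota -lt0n (leq_ltn_trans _ lx) //.
by split=> //; case: x lx => [[i j] k].
Qed.

Lemma lcoef_Zpi pi x l : lcoef (Zpi pi) (emb (x, l)) = (l < pi x)%N%:Z.
Proof.
rewrite ZpiE lcoef_sum -mem_boxes -(count_uniq_mem _ (boxes_uniq pi)).
elim: (boxes pi) => [|b s ih]; rewrite ?big_nil // big_cons ih lcoef_term /= PoszD.
by case: eqP.
Qed.

(** The coefficient at [(x, l)] is 1 exactly when [l < pi x], so an entry of the table determines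
    its partition. *)
Lemma Zpi_inj pi pi' : Zpi pi = Zpi pi' -> pi = pi'.
Proof.
move=> e; have h x l : (l < pi x)%N = (l < pi' x)%N.
  have /eqP := lcoef_Zpi pi x l; rewrite e lcoef_Zpi.
  by rewrite eqz_nat; case: (l < pi x)%N; case: (l < pi' x)%N.
apply/fsfunP => x; apply/eqP; rewrite eqn_leq; apply/andP; split.
  by rewrite leqNgt h ltnn.
by rewrite leqNgt -h ltnn.
Qed.

Definition tmono (p : nb) : laurent := let: (a, b, c, d) := p in
  t1 ^+ a * t2 ^+ b * t3 ^+ c * t4 ^+ d.

Lemma tm_emb p : tm (emb p) = tmono p.
Proof.
have x1 a : t1 ^+ a = tm (a%:Z, 0, 0, 0) by elim: a => // a ih; rewrite exprS ih tmD.
have x2 a : t2 ^+ a = tm (0, a%:Z, 0, 0) by elim: a => // a ih; rewrite exprS ih tmD.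
have x3 a : t3 ^+ a = tm (0, 0, a%:Z, 0) by elim: a => // a ih; rewrite exprS ih tmD.
have x4 a : t4 ^+ a = tm (0, 0, 0, a%:Z) by elim: a => // a ih; rewrite exprS ih tmD.
case: p => [[[a b] c] d]; rewrite /tmono x1 x2 x3 x4 !tmD !wtE.
congr (tm (_, _, _, _)).
- by rewrite -!addrA !addr0.
- by rewrite add0r -!addrA !addr0.
- by rewrite !add0r addr0.
Qed.

Lemma omega_listed s (Z : laurent) (v : rat) (p q : nat) :
  [&& check s, q != 0%N & ntuples s * q == p * (height s)`!]%N ->
  Z = \sum_(b <- cboxes s) tmono b -> v = p%:R / q%:R ->
  forall (pi : array3) (w : K), is_solid pi -> Zpi pi = Z -> is_wpi pi w ->
  exists2 om : rat, is_omega pi w om & `|om| = omega_c pi /\ omega_c pi = v.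
Proof.
case/and3P => chk q0 /eqP e -> -> pi w _ ZE wpi.
have ws : wf s by case/and5P: chk.
have piE : pi = arr s.
  apply: Zpi_inj; rewrite ZE ZpiE (perm_big _ (boxes_arr ws)) big_map.
  by apply: eq_bigr => b _; rewrite tm_emb.
rewrite piE in wpi *; have [om h omE] := check_omega chk wpi.
exists om => //; split=> //; case/and5P: chk => _ /eqP hd _ _ _.
rewrite omega_cE // -/(ntuples s) -/(height s).
by apply/eqP; rewrite eqr_div ?pnatr_eq0 -?lt0n ?fact_gt0 // -?natrM ?e // lt0n.
Qed.

Definition listed_values : seq (nat * nat) :=
  [:: (3, 2); (3, 1); (6, 1); (2, 1); (8, 1); (6, 1); (8, 3); (5, 6); (5, 3)]%N.

Lemma listed_check : all (fun sv => let: (s, (p, q)) := sv in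
  [&& check s, q != 0%N & ntuples s * q == p * (height s)`!]%N) (zip listed listed_values).
Proof. by vm_cast_no_check (erefl true). Qed.

Lemma omega_table (Z : laurent) (v : rat) : 
     (Z, v) \in
       [:: (1 + t1 + t2 + t1 * t2 + t3 + t4 + t4 ^+ 2, 3 / 2);
           (1 + t1 + t2 + t1 * t2 + t3 + t4 + t1 * t4 + t4 ^+ 2, 3);
           (1 + t1 + t1 ^+ 2 + t2 + t1 * t2 + t3 + t4 + t1 * t4 + t4 ^+ 2, 6);
           (1 + t1 + t1 ^+ 2 + t2 + t1 * t2 + t2 * t3 + t3 + t4 + t1 * t4
            + t4 ^+ 2, 2);
           (1 + t1 + t1 ^+ 2 + t2 + t1 * t2 + t2 * t3 + t3 + t4 + t1 * t4
            + t2 * t4 + t4 ^+ 2, 8);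
           (1 + t1 + t1 ^+ 2 + t2 + t1 * t2 + t2 * t3 + t3 + t4 + t1 * t4
            + t2 * t4 + t4 ^+ 2 + t4 ^+ 3, 6);
           (1 + t1 + t1 ^+ 2 + t2 + t1 * t2 + t2 * t3 + t3 + t4 + t1 * t4
            + t2 * t4 + t4 ^+ 2 + t4 ^+ 3 + t4 ^+ 4, 8 / 3);
           (1 + t1 + t1 ^+ 2 + t2 + t1 * t2 + t2 * t3 + t3 + t4 + t1 * t4
            + t2 * t4 + t4 ^+ 2 + t4 ^+ 3 + t4 ^+ 4 + t4 ^+ 5, 5 / 6);
           (1 + t1 + t1 ^+ 2 + t2 + t2 ^+ 2 + t1 * t2 + t2 * t3 + t3 + t4
            + t1 * t4 + t2 * t4 + t4 ^+ 2 + t4 ^+ 3 + t4 ^+ 4 + t4 ^+ 5,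
            5 / 3)] ->
     forall (pi : array3) (w : K),
       is_solid pi -> Zpi pi = Z -> is_wpi pi w ->
       exists2 om : rat, is_omega pi w om & `|om| = omega_c pi /\ omega_c pi = v.
Proof.
have := listed_check; rewrite /listed /listed_values.
case/andP=> h1 /andP[h2] /andP[h3] /andP[h4] /andP[h5] /andP[h6] /andP[h7] /andP[h8] /andP[h9 _].
have tableP s p q Z' v' : [&& check s, q != 0%N & ntuples s * q == p * (height s)`!]%N ->
    Z' = \sum_(b <- cboxes s) tmono b -> v' = p%:R / q%:R -> (Z, v) == (Z', v') ->
    forall (pi : array3) (w : K), is_solid pi -> Zpi pi = Z -> is_wpi pi w ->
    exists2 om : rat, is_omega pi w om & `|om| = omega_c pi /\ omega_c pi = v.
  by move=> h ZE vE /eqP[-> ->]; exact: omega_listed h ZE vE.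
rewrite !inE; case/orP; [apply: (tableP _ _ _ _ _ h1)|case/orP;
 [apply: (tableP _ _ _ _ _ h2)|case/orP; [apply: (tableP _ _ _ _ _ h3)|case/orP;
 [apply: (tableP _ _ _ _ _ h4)|case/orP; [apply: (tableP _ _ _ _ _ h5)|case/orP;
 [apply: (tableP _ _ _ _ _ h6)|case/orP; [apply: (tableP _ _ _ _ _ h7)|case/orP;
 [apply: (tableP _ _ _ _ _ h8)|apply: (tableP _ _ _ _ _ h9)]]]]]]]].
(* These are the goals about values; the integral ones occur as quotients by 1. *)
all: try (match goal with |- @eq _ _ (_ / _) => idtac end; by rewrite ?divr1).
all: rewrite unlock /=; move: t1 t2 t3 t4 => x1 x2 x3 x4; ring.
Qed.

(** * Plane partitions *)

Definition ind (m : int) (w : wt) : int := (diag w && (dm w == m))%:Z.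

Lemma lcoef_pushE f p w : lcoef (lpush f p) w = lsum (fun v => (f v == w)%:Z) p.
Proof.
by rewrite lcoef_sum; apply: eq_bigr => v _; rewrite lcoef_term -mulr_natr natz.
Qed.

(** [gm] depends only on the multiple $m(1,1,1)$ that a weight represents, so the product is
    determined by the total multiplicities of the various $m$. *)
Lemma lprod_gm_ind p : (forall m, lsum (ind m) p = 0) -> lprod gm p = 1.
Proof.
(* [tau] merges all weights with the same $m$ into one; the last component 1 keeps the diagonal
   weights with $m=0$ apart from the non-diagonal ones. *)
move=> p0; pose tau w : wt := if diag w then (dm w, 0, 0, 1) else 0.
pose h (w : wt) : rat :=
  if (w.2 == 1) && (w.1.1.1 != 0) then (w.1.1.1)%:~R else 1.
have h0 : nz h.
  move=> w; rewrite /h; case: ifP => [/andP[_]|_]; last exact: oner_neq0.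
  by rewrite intr_eq0.
have -> : lprod gm p = lprod h (lpush tau p).
  rewrite (lprod_push h0); apply: eq_lprod => w.
  rewrite /gm /h /= /tau; case dw: (diag w) => //=.
  by rewrite triv_dm.
rewrite /lprod big_seq big1 // => w; rewrite -lcoef_neq0 => nz.
have [v e] := lcoef_push nz; rewrite lcoef_pushE in nz.
rewrite -{}e {w} in nz *; rewrite {1}/tau; case dv: (diag v); last by rewrite /h /= exp1rz.
case/eqP: nz; rewrite -[RHS](p0 (dm v)); apply: eq_lsum => u.
rewrite /ind /tau dv; case du: (diag u) => /=; last by case: eqP => // /(congr1 snd).
by rewrite !xpair_eqE !eqxx !andbT.
Qed.

Lemma trivz_ind w : trivz w = ind 0 w.
Proof.
rewrite /trivz /ind; case dw: (diag w); first by rewrite triv_dm.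
by case tw: (triv w); rewrite ?(triv_diag tw) in dw *.
Qed.

Section Plane.
Variable pi : array3.
Hypothesis sol : is_solid pi.
Hypothesis pi0 : pi (0, 0, 0)%N = 1%N.

Lemma plane_le x y : (x.1.1 <= y.1.1)%N -> (x.1.2 <= y.1.2)%N -> (x.2 <= y.2)%N ->
  (pi y <= pi x)%N.
Proof.
case: x y => [[i j] k] [[i' j'] k'] /= /subnKC <- /subnKC <- /subnKC <-.
apply: (@leq_trans (pi (i, (j + (j' - j))%N, (k + (k' - k))%N))).
  elim: (i' - i)%N => [|n]; rewrite ?addn0 // addnS; apply: leq_trans.
  by case: (sol (i + n) (j + (j' - j)) (k + (k' - k)))%N.
apply: (@leq_trans (pi (i, j, (k + (k' - k))%N))).
  elim: (j' - j)%N => [|n]; rewrite ?addn0 // addnS; apply: leq_trans.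
  by case: (sol i (j + n) (k + (k' - k)))%N.
elim: (k' - k)%N => [|n]; rewrite ?addn0 // addnS; apply: leq_trans.
by case: (sol i j (k + n))%N.
Qed.

Lemma plane_val x : x \in finsupp pi -> pi x = 1%N.
Proof.
rewrite mem_finsupp -lt0n => p0; apply/eqP; rewrite eqn_leq p0 andbT -pi0.
exact: plane_le.
Qed.

Lemma boxes_plane : boxes pi = [seq emb (x, 0%N) | x <- finsupp pi].
Proof.
have h (s : seq pos) : {subset s <= finsupp pi} ->
    [seq (x.1.1%:Z, x.1.2%:Z, x.2%:Z, l%:Z) | x <- s, l <- iota 0 (pi x)]
    = [seq emb (x, 0%N) | x <- s].
  elim: s => //= x s ih sub; rewrite plane_val ?sub ?mem_head //= ih.
    by case: x {sub} => [[i j] k].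
  by move=> y ys; apply: sub; rewrite inE ys orbT.
exact: h.
Qed.

Definition subs : seq (int * pos) :=
  [:: (1, (0, 0, 0)%N); (-1, (1, 0, 0)%N); (-1, (0, 1, 0)%N); (-1, (0, 0, 1)%N);
      (1, (1, 1, 0)%N); (1, (1, 0, 1)%N); (1, (0, 1, 1)%N); (-1, (1, 1, 1)%N)].

Lemma Pbar_subs : (1 - u1) * (1 - u2) * (1 - u3) =
  \sum_(e <- subs) lterm e.1 (- emb (e.2, 0%N)).
Proof.
have lN w : lterm (-1) w = - tm w.
  by apply/eqP; rewrite -addr_eq0 -ltermD addNr lterm0.
rewrite !big_cons big_nil addr0 /= !lN -![lterm 1 _]/(tm _) tm0.
have -> : tm (- (1, 0, 0, 0)) = u1 by [].
have -> : tm (- (0, 1, 0, 0)) = u2 by [].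
have -> : tm (- (0, 0, 1, 0)) = u3 by [].
have -> : tm (- (1, 1, 0, 0)) = u1 * u2 by rewrite tmD.
have -> : tm (- (1, 0, 1, 0)) = u1 * u3 by rewrite tmD.
have -> : tm (- (0, 1, 1, 0)) = u2 * u3 by rewrite tmD.
have -> : tm (- (1, 1, 1, 0)) = u1 * u2 * u3 by rewrite !tmD.
by move: u1 u2 u3 => a b c; ring.
Qed.

Let X : seq pos := finsupp pi.

Lemma Zpi_plane : Zpi pi = \sum_(a <- X) tm (emb (a, 0%N)).
Proof. by rewrite ZpiE boxes_plane big_map. Qed.

Lemma bar_plane : bar (Zpi pi) = \sum_(a <- X) tm (- emb (a, 0%N)).
Proof.
by rewrite Zpi_plane /bar lpush_sum; apply: eq_bigr => a _; rewrite lpush_term.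
Qed.

Lemma lsum_pairs_subs g : lsum g (Zpi pi * bar (Zpi pi) * ((1 - u1) * (1 - u2) * (1 - u3))) =
  \sum_(e <- subs) e.1 *
    \sum_(a <- X) \sum_(b <- X) g (emb (a, 0%N) - emb (b, 0%N) - emb (e.2, 0%N)).
Proof.
rewrite Pbar_subs mulr_sumr lsum_sum; apply: eq_bigr => e _.
rewrite bar_plane Zpi_plane mulr_suml mulr_suml lsum_sum mulr_sumr.
apply: eq_bigr => a _; rewrite mulr_sumr mulr_suml lsum_sum mulr_sumr.
by apply: eq_bigr => b _; rewrite tmD [_ * _]lmul_term lsum_term mul1r.
Qed.

Lemma ind_shift m (a b s : pos) :
  ind m (emb (a, 0%N) - emb (b, 0%N) - emb (s, 0%N)) =
  [&& a.1.1%:Z == b.1.1%:Z + (m + s.1.1%:Z), a.1.2%:Z == b.1.2%:Z + (m + s.1.2%:Z)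
    & a.2%:Z == b.2%:Z + (m + s.2%:Z)].
Proof.
case: a b s => [[a1 a2] a3] [[b1 b2] b3] [[s1 s2] s3].
rewrite /emb !wtN !wtE /ind /diag /dm /= subr0.
have e (x y z : int) : (x == y + (m + z)) = (x - y - z == m).
  by apply/eqP/eqP => [->|<-]; ring.
rewrite !e; congr (Posz (nat_of_bool _)).
set x := _ - s1%:Z; set y := _ - s2%:Z; set z := _ - s3%:Z.
apply/andP/and3P => [[/andP[/eqP <- /eqP <-] ->] //|[/eqP -> /eqP -> /eqP ->]].
by rewrite !eqxx.
Qed.

Definition above (n : nat) (s : pos) : int := \sum_(a <- X)
  ([&& n + s.1.1 <= a.1.1, n + s.1.2 <= a.1.2 & n + s.2 <= a.2]%N : int).

(** The only candidate for [b] is the difference of [a] and [c]; where it exists it lies in the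
    support, which is closed downwards. *)
Lemma sum_below a (c : pos) : a \in X ->
  \sum_(b <- X) ([&& a.1.1 == b.1.1 + c.1.1, a.1.2 == b.1.2 + c.1.2
                  & a.2 == b.2 + c.2]%N : int) =
  [&& c.1.1 <= a.1.1, c.1.2 <= a.1.2 & c.2 <= a.2]%N.
Proof.
move=> aX; set d : pos := (a.1.1 - c.1.1, a.1.2 - c.1.2, a.2 - c.2)%N.
case: and3P => [[c1 c2 c3]|nc].
  have dX : d \in X.
    rewrite mem_finsupp -lt0n; apply: leq_trans (_ : pi a <= _)%N.
      by rewrite (plane_val aX).
    by apply: plane_le; rewrite /d /= leq_subr.
  rewrite (bigD1_seq d) ?fset_uniq //= !subnK // !eqxx big1 ?addr0 //.
  move=> b bd; case: and3P => // -[/eqP e1 /eqP e2 /eqP e3].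
  case/eqP: bd; rewrite /d e1 e2 e3 !addnK.
  by case: b {e1 e2 e3} => [[]].
rewrite big1 // => b _; case: and3P => // -[/eqP e1 /eqP e2 /eqP e3].
by case: nc; rewrite e1 e2 e3 !leq_addl.
Qed.

Lemma sum_ind_pos (n : nat) (s : pos) :
  \sum_(a <- X) \sum_(b <- X)
    ind n (emb (a, 0%N) - emb (b, 0%N) - emb (s, 0%N)) = above n s.
Proof.
rewrite /above big_seq [RHS]big_seq; apply: eq_bigr => a aX.
rewrite -(@sum_below a (n + s.1.1, n + s.1.2, n + s.2)%N) //.
by apply: eq_bigr => b _; rewrite ind_shift -!PoszD !eqz_nat.
Qed.

(** For a negative multiple the roles of $a$ and $b$ are exchanged: $b=a+(n+1)(1,1,1)-s$, and
    $(1,1,1)-s$ is the opposite vertex $s'$ of the cube. *)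
Lemma sum_ind_neg (n : nat) (s s' : pos) :
  (s.1.1 + s'.1.1 = 1)%N -> (s.1.2 + s'.1.2 = 1)%N -> (s.2 + s'.2 = 1)%N ->
  \sum_(a <- X) \sum_(b <- X)
    ind (- n.+1%:Z) (emb (a, 0%N) - emb (b, 0%N) - emb (s, 0%N)) = above n s'.
Proof.
move=> s1 s2 s3; rewrite exchange_big /= /above big_seq [RHS]big_seq.
apply: eq_bigr => b bX.
rewrite -(@sum_below b (n + s'.1.1, n + s'.1.2, n + s'.2)%N) //.
apply: eq_bigr => a _; rewrite ind_shift -!eqz_nat !PoszD.
have h (x y : int) (t t' : nat) : (t + t' = 1)%N ->
    (x == y + (- n.+1%:Z + t%:Z)) = (y == x + (n%:Z + t'%:Z)).
  move=> tt; have -> : n.+1%:Z = n%:Z + t%:Z + t'%:Z by rewrite -!PoszD -addnA tt addn1.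
  by apply/eqP/eqP => ->; ring.
by rewrite (h _ _ _ _ s1) (h _ _ _ _ s2) (h _ _ _ _ s3).
Qed.

(** The signed sum over the vertices factors over the coordinates into differences
    $[n\leqslant x]-[n+1\leqslant x]=[x=n]$, so only the box $(n,n,n)$ is left. *)
Lemma sum_above n : \sum_(e <- subs) e.1 * above n e.2 = ((n, n, n) \in X)%N.
Proof.
under eq_bigr do rewrite mulr_sumr.
rewrite exchange_big /=.
transitivity (\sum_(a <- X) ((a == (n, n, n)) : int)).
  apply: eq_bigr => -[[i j] k] _.
  rewrite !big_cons big_nil /= !xpair_eqE.
  have h x : (x == n)%:Z = (n + 0 <= x)%N%:Z - (n + 1 <= x)%N%:Z.
    by rewrite addn0 addn1; case: ltngtP.
  have andE (b c : bool) : (b && c)%:Z = b%:Z * c%:Z by case: b; case: c.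
  rewrite !andE !h.
  move: (n + 0 <= i)%N%:Z (n + 1 <= i)%N%:Z (n + 0 <= j)%N%:Z (n + 1 <= j)%N%:Z
    (n + 0 <= k)%N%:Z (n + 1 <= k)%N%:Z => a b c d e f.
  by ring.
rewrite -(count_uniq_mem _ (fset_uniq (finsupp pi))) -/X.
elim: X => [|x s ih]; rewrite ?big_nil // big_cons ih /= PoszD.
by [].
Qed.

Definition Vplane : laurent := Vhalf pi - bar (Zpi pi) * t4.

(** For $m=n\geqslant0$ the box $(n,n,n)$ counted by $Z$ cancels against the pairs, and
    $\overline{Z}t_4$ has only negative multiples. For $m=-(n+1)$ it is $\overline{Z}t_4$ that
    cancels the pairs, and $Z$ does not contribute. *)
Lemma lsum_Vplane m : lsum (ind m) Vplane = 0.
Proof.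
rewrite /Vplane /Vhalf !lsumD !lsumN lsum_pairs_subs bar_plane Zpi_plane mulr_suml.
rewrite !lsum_sum.
under eq_bigr do rewrite lsum_tm.
under [X in _ - X]eq_bigr do rewrite tmD lsum_tm.
have cnt (g : pos -> bool) n : (forall a, g a = (a == (n, n, n)%N)) ->
    \sum_(a <- X) (g a : int) = ((n, n, n) \in X)%N.
  move=> gE; rewrite -(count_uniq_mem _ (fset_uniq (finsupp pi))) -/X.
  elim: X => [|x s ih]; rewrite ?big_nil // big_cons ih /= PoszD gE.
  by [].
case: m => n.
  under [X in _ - X - _]eq_bigr do rewrite sum_ind_pos.
  rewrite sum_above (cnt _ n) ?subrr ?add0r.
    rewrite big1 ?oppr0 // => -[[i j] k] _.
    rewrite /ind; case: eqP => [|_]; last by rewrite andbF.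
    by rewrite /dm /=; lia.
  move=> [[i j] k]; rewrite /diag /dm /= subr0 !eqz_nat !xpair_eqE.
  by lia.
rewrite NegzE.
(* Opposite vertices of the cube have opposite parity, whence the minus sign. *)
have -> : \sum_(e <- subs) e.1 * (\sum_(a <- X) \sum_(b <- X)
    ind (- n.+1%:Z) (emb (a, 0%N) - emb (b, 0%N) - emb (e.2, 0%N))) =
  - \sum_(e <- subs) e.1 * above n e.2.
  rewrite !big_cons !big_nil /=.
  rewrite (@sum_ind_neg n (0, 0, 0)%N (1, 1, 1)%N) //.
  rewrite (@sum_ind_neg n (1, 0, 0)%N (0, 1, 1)%N) //.
  rewrite (@sum_ind_neg n (0, 1, 0)%N (1, 0, 1)%N) //.
  rewrite (@sum_ind_neg n (0, 0, 1)%N (1, 1, 0)%N) //.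
  rewrite (@sum_ind_neg n (1, 1, 0)%N (0, 0, 1)%N) //.
  rewrite (@sum_ind_neg n (1, 0, 1)%N (0, 1, 0)%N) //.
  rewrite (@sum_ind_neg n (0, 1, 1)%N (1, 0, 0)%N) //.
  rewrite (@sum_ind_neg n (1, 1, 1)%N (0, 0, 0)%N) //.
  by ring.
rewrite sum_above opprK [X in X + _ - _]big1 ?add0r; last first.
  move=> [[i j] k] _; rewrite /ind; case: eqP => [|_]; last by rewrite andbF.
  by rewrite /dm /=; lia.
rewrite (cnt _ n) ?subrr // => -[[i j] k].
rewrite wtN wtE /diag /dm /= !addr0 !eqr_opp !eqz_nat !xpair_eqE.
have -> : (- i%:Z - (0 + 1) == - n.+1%:Z) = (i == n) by lia.
by lia.
Qed.
End Plane.

Section Plane.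
Variable pi : array3.
Hypothesis sol : is_solid pi.
Hypothesis pi0 : pi (0, 0, 0)%N = 1%N.

Let X : seq pos := finsupp pi.

Let plane1 x : pi x = (x \in X) :> nat.
Proof.
case xX: (x \in X); first exact: plane_val sol pi0 _ xX.
by rewrite fsfun_dflt // xX.
Qed.

Lemma plane_family_exists : exists2 xi : array2, is_plane xi /\ xi <> [fsfun]
  & forall x, box xi x = (x \in X).
Proof.
pose b := nseq (size X) true.
have bitE x : bit X b x = (x \in X) by rewrite /bit nth_nseq index_mem; case: ifP.
have sb : size b = size X by rewrite size_nseq.
have db : isdown X b.
  apply/allP => x xX; rewrite bitE xX; apply/allP => y yx; rewrite bitE.
  rewrite mem_finsupp -lt0n; apply: leq_trans (solid_preds sol yx).
  by rewrite (plane1 x) xX.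
have : xi_of X b \in planes X.
  apply/mapP; exists b => //; rewrite mem_filter mem_allbits sb eqxx db bitE.
  by rewrite mem_finsupp pi0.
move=> /mem_planes[pxi xi0 _]; exists (xi_of X b) => // x.
by rewrite box_xi_of ?sb.
Qed.

(** The corner value 1 allows a single plane partition, taken once, and it has to be [pi] itself; so
    there is one family and its weight is $1/1!$. *)
Lemma omega_c_plane : omega_c pi = 1.
Proof.
rewrite /omega_c; case: eqP => // _.
have [xi [pxi xi0] bxi] := plane_family_exists.
have -> : Cpi pi = [set upd [fsfun] xi 1]%classic.
  apply/seteqP; split=> m /=; last first.
    move=> ->; have supp : finsupp (upd [fsfun] xi 1) = [fset xi]%fset.
      by apply/fsetP => z; rewrite mem_finsupp updE !inE; case: (z =P xi) => //; rewrite fsfunE.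
    split=> [z|i j k].
      by rewrite updE; case: (z =P xi) => [->|]; rewrite ?fsfunE.
    rewrite supp big_seq_fset1 updE eqxx mul1n plane1.
    by rewrite -bxi.
  move=> [mp mf].
  have corner z : z \in finsupp m -> box z (0, 0, 0)%N.
    by rewrite mem_finsupp => /mp[pz z0]; exact: plane_corner.
  have sum1 := mf 0%N 0%N 0%N; rewrite pi0 in sum1.
  have [m0|[z zm]] := fset_0Vmem (finsupp m).
    by rewrite m0 big_seq_fset0 in sum1.
  have mz : m z != 0%N by rewrite -mem_finsupp.
  have mzD x : pi x = (m z * box z x + \sum_(y <- finsupp m | y != z) m y * box y x)%N.
    by case: x => [[i j] k]; rewrite mf (bigD1_seq z) ?fset_uniq.
  have := mzD (0, 0, 0)%N; rewrite pi0 corner // muln1.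
  (* At the corner 1 is the sum of the nonzero [m z] and the rest, so [m z] is 1 and the rest is
     0. *)
  move: mz; case e: (m z) => [|[|n]] // _; rewrite add1n => -[] rest.
  have only y : y != z -> m y = 0%N.
    move=> yz; apply: contraPeq rest => my; have ym : y \in finsupp m by rewrite mem_finsupp.
    by rewrite big_mkcond (bigD1_seq y) ?fset_uniq //= yz corner // muln1; case: (m y) my.
  have rest0 x : (\sum_(y <- finsupp m | y != z) m y * box y x = 0)%N.
    by rewrite big1 // => y /only ->.
  have zxi : z = xi.
    apply: array2_ext => x; rewrite bxi; have := mzD x.
    rewrite rest0 addn0 e mul1n plane1.
    by case: (box z x); case: (x \in X).
  apply/fsfunP => y; rewrite updE -zxi.
  by case: (y =P z) => [->|/eqP /only ->]; rewrite ?fsfunE.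
rewrite fsbig_set1.
have supp : finsupp (upd [fsfun] xi 1) = [fset xi]%fset.
  by apply/fsetP => z; rewrite mem_finsupp updE !inE; case: (z =P xi) => //; rewrite fsfunE.
by rewrite supp big_seq_fset1 updE eqxx invr1.
Qed.

Let VhalfE : Vhalf pi = Vplane pi + \sum_(a <- X) tm (- emb (a, 0%N) + (0, 0, 0, 1)).
Proof.
rewrite /Vplane (bar_plane sol pi0) mulr_suml.
by under eq_bigr do rewrite tmD; rewrite subrK.
Qed.

Lemma triv_plane : lsum trivz (Vhalf pi) = 0.
Proof.
rewrite VhalfE lsumD (eq_lsum _ trivz_ind) (lsum_Vplane sol pi0) add0r lsum_sum.
apply: big1 => -[[i j] k] _; rewrite lsum_tm /trivz /emb wtN wtE /triv.
by case: eqP => //; lia.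
Qed.

Lemma gm_plane (a : pos) : `|gm (- emb (a, 0%N) + (0, 0, 0, 1))| =
  if diag (emb (a, 0%N)) then a.1.1.+1%:R else 1.
Proof.
rewrite /gm diag_t4 diagN; case da: (diag _); last by rewrite normr1.
have dmE : dm (- emb (a, 0%N) + (0, 0, 0, 1)) = - a.1.1.+1%:Z.
  by case: a {da} => [[i j] k]; rewrite /emb wtN wtE /dm /=; lia.
by rewrite triv_dm ?diag_t4 ?diagN // dmE /= mulrNz normrN normr_nat.
Qed.

(** At $d=1$ a diagonal box $(i,i,i)$ gives $1+i$ in $L$, and by [gm_plane] its conjugate shifted by
    $t_4$ gives $i+1$ in the class of [Vhalf]. These cancel, [Vplane] contributes 1, and
    $|\omega|=1$. *)
Lemma omega_plane (w : K) : is_wpi pi w ->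
  exists2 om : rat, is_omega_at 1 pi w om & `|om| = omega_c pi.
Proof.
move=> wpi; have [s sp] := spec_Lw triv_plane wpi.
set R := (lprod gm _)^-1 in sp; set D : rat := \prod_(b <- boxes pi | diag b) (1 + (dm b)%:~R).
exists ((-1) ^+ psize pi * ((-1) ^+ s * R * D)).
  rewrite /is_omega_at pi0 big_ord1 subr0 mulr1 signrMK.
  rewrite -/(rat_K 1) Lpi_scalarE mulrC.
  have := pspec_horner sp (sp_rat 1); rewrite !hornerZ.
  have -> // : rat_K0 ((-1) ^+ s * R) *
     (\prod_(b <- boxes pi | diag b) ('X + ((dm b)%:~R)%:P)).[rat_K0 1] =
     rat_K0 ((-1) ^+ s * R * D).
  rewrite [RHS]rmorphM /=; congr (_ * _); rewrite horner_prod rmorph_prod.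
  apply: eq_bigr => b _; rewrite hornerD hornerX hornerC.
  by rewrite /= [RHS]rmorphD /= rmorph_int.
rewrite omega_c_plane !normrM !normr_sign !mul1r normfV VhalfE (lprodD gm_nz).
rewrite (lprod_gm_ind (lsum_Vplane sol pi0)) mul1r (lprod_sum gm_nz) normr_prod.
rewrite /D normr_prod (boxes_plane sol pi0) big_map.
under eq_bigr do rewrite lprod_tm gm_plane.
rewrite -big_mkcond [X in _ * X](eq_bigr (fun a : pos => a.1.1.+1%:R)); last first.
  move=> [[i j] k] _; have -> : dm (emb (i, j, k, 0%N)) = i by rewrite /dm /emb /=; lia.
  by rewrite -pmulrn -[1]/(1%:R) -natrD normr_nat.
rewrite mulVf // prodf_seq_neq0; apply/allP => a _.
by rewrite pnatr_eq0 implybT.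
Qed.
End Plane.

(** * Powers of the MacMahon function *)

Section SeriesODE.
Variable F : fieldType.
Implicit Types (f g p : {poly F}).
Hypothesis F0 : forall n, n.+1%:R != 0 :> F.

Lemma deriv_log_sum n f :
  f * (\sum_(1 <= k < n.+1) ((-1) ^+ k.+1 / k%:R) *: (f - 1) ^+ k)^`() =
  f^`() * (1 - (1 - f) ^+ n).
Proof.
rewrite raddf_sum big_add1 /= big_mkord.
have -> : \sum_(i < n) (((-1) ^+ i.+2 / i.+1%:R) *: (f - 1) ^+ i.+1)^`() =
    f^`() * \sum_(i < n) (1 - f) ^+ i.
  rewrite mulr_sumr; apply: eq_bigr => i _.
  rewrite derivZ deriv_exp derivB -polyC1 derivC subr0 /= -scaler_nat scalerA divfK //.
  rewrite scalerAr; congr (_ * _); rewrite polyC1 -[1 - f]opprB [in RHS]exprNn.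
  have -> : (-1) ^+ i.+2 = (-1) ^+ i :> F by rewrite !exprS !mulN1r opprK.
  rewrite -signr_odd -[in RHS]signr_odd; case: (odd i).
    by rewrite !expr1 scaleN1r mulN1r.
  by rewrite !expr0 scale1r mul1r.
rewrite mulrCA; congr (_ * _).
by rewrite -[RHS]opprB subrX1 addrAC subrr add0r mulNr opprK.
Qed.

Lemma deriv_exp_sum n g :
  (\sum_(k < n.+1) (k`!%:R)^-1 *: g ^+ k)^`() =
  g^`() * (\sum_(k < n.+1) (k`!%:R)^-1 *: g ^+ k - (n`!%:R)^-1 *: g ^+ n).
Proof.
rewrite [in RHS]big_ord_recr addrK /=.
rewrite big_ord_recl /= raddfD /= expr0 derivZ derivC scaler0 add0r.
rewrite raddf_sum mulr_sumr; apply: eq_bigr => i _ /=.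
rewrite derivZ deriv_exp /= -scaler_nat scalerA factS natrM.
by rewrite invfM mulrAC mulVf // mul1r scalerAr.
Qed.

(* L and E are the truncations of log f and exp (a log f). *)
Lemma series_ode n f a (L := \sum_(1 <= k < n.+1) ((-1) ^+ k.+1 / k%:R) *: (f - 1) ^+ k)
    (E := \sum_(k < n.+1) (k`!%:R)^-1 *: (a *: L) ^+ k) :
  f`_0 = 1 -> forall m, (m < n)%N -> (f * E^`())`_m = a * (f^`() * E)`_m.
Proof.
move=> f0 m mn.
(* Neither $1-f$ nor $L$ has a constant term, so the truncation errors, which involve $(1-f)^n$ and
   $(aL)^n/n!$, are multiples of $X^n$. *)
have [v fE] : exists v, 1 - f = v * 'X.
  exists (\poly_(i < size f) (- f`_i.+1)); apply/polyP => -[|i].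
    by rewrite coefMX coefB coef1 f0 subrr.
  rewrite coefMX coefB coef1 sub0r /= coef_poly; case: ltnP => // le.
  by rewrite nth_default ?oppr0 // leqW.
have [u LE] : exists u, L = u * 'X.
  exists (\sum_(1 <= k < n.+1) ((-1) ^+ k.+1 / k%:R) *: ((f - 1) ^+ k.-1 * - v)).
  rewrite /L mulr_suml big_nat [RHS]big_nat; apply: eq_bigr => -[|k] //= _.
  rewrite -scalerAl -[_ * - v * _]mulrA mulNr -fE opprB; congr (_ *: _).
  exact: exprSr.
have fL : f * L^`() = f^`() * (1 - v ^+ n * 'X^n).
  by rewrite deriv_log_sum fE exprMn.
pose c : F := n`!%:R^-1; pose R := a%:P * f^`() *
  (- (v ^+ n * E) - c%:P * (a%:P * u) ^+ n * (1 - v ^+ n * 'X^n)).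
have -> : f * E^`() = a *: (f^`() * E) + R * 'X^n.
  rewrite /E deriv_exp_sum derivZ -/E -!mul_polyC -/c.
  have -> : (a%:P * L) ^+ n = (a%:P * u) ^+ n * 'X^n by rewrite LE mulrA exprMn.
  have -> : f * (a%:P * L^`() * (E - c%:P * ((a%:P * u) ^+ n * 'X^n))) =
    a%:P * (f * L^`()) * (E - c%:P * ((a%:P * u) ^+ n * 'X^n)) by ring.
  by rewrite fL /R; ring.
by rewrite coefD coefZ coefMXn mn addr0.
Qed.

Lemma exp_log_coef0 n f a : f`_0 = 1 ->
  (\sum_(k < n.+1) (k`!%:R)^-1 *:
    (a *: \sum_(1 <= k < n.+1) ((-1) ^+ k.+1 / k%:R) *: (f - 1) ^+ k) ^+ k)`_0 = 1.
Proof.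
set L := \sum_(1 <= k < _) _ => f0; have L0 : L.[0] = 0.
  rewrite horner_sum big_nat big1 // => -[|k] // _.
  by rewrite hornerZ horner_exp hornerD hornerN hornerC horner_coef0 f0 subrr expr0n mulr0.
rewrite -horner_coef0 horner_sum big_ord_recl big1 => [|i _].
  by rewrite fact0 invr1 expr0 scale1r hornerC addr0.
by rewrite hornerZ horner_exp hornerZ L0 mulr0 expr0n mulr0.
Qed.
End SeriesODE.

Lemma K_nat_neq0 n : n.+1%:R != 0 :> K.
Proof. by rewrite -(rmorph_nat rat_K) fmorph_eq0 pnatr_eq0. Qed.

Lemma spMn x y n : specializes_to x y -> specializes_to (x *+ n) (y *+ n).
Proof.
move=> s; elim: n => [|n ih]; first by rewrite !mulr0n; exact: sp0.
by rewrite !mulrSr; exact: spD.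
Qed.

Lemma intr_mulrn (R : pzRingType) (z : int) n : (z *+ n)%:~R = z%:~R *+ n :> R.
Proof. exact: rmorphMn. Qed.

Lemma spMn_inv x y n : specializes_to (x *+ n.+1) (y *+ n.+1) -> specializes_to x y.
Proof.
have divE (F : fieldType) (u : F) : n.+1%:R != 0 :> F -> u = u *+ n.+1 / n.+1%:R.
  by move=> n0; rewrite -[u *+ _]mulr_natr mulfK.
have k0 : n.+1%:R != 0 :> K0 by rewrite -(rmorph_nat rat_K0) fmorph_eq0 pnatr_eq0.
move=> s; rewrite (divE _ x (K_nat_neq0 n)) (divE _ y k0).
by apply: spM => //; apply: spV => //; exact: spMn sp1.
Qed.

(** The equation $fE'=af'E$ with $E_0=1$ determines $(m+1)E_{m+1}$ from lower coefficients. The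
    integers [r] obey the same recursion with the limit $c$ of $a$, so the limits agree by
    induction, without specializing the exponential itself. *)
Lemma spec_ode (fz r : nat -> int) (c : int) (f E : {poly K}) a N :
  specializes_to a c%:~R -> f`_0 = 1 -> E`_0 = 1 -> r 0%N = 1 -> fz 0%N = 1 ->
  (forall i, (i <= N)%N -> f`_i = (fz i)%:~R) ->
  (forall m, (m < N)%N -> (f * E^`())`_m = a * (f^`() * E)`_m) ->
  (forall m, (m < N)%N -> \sum_(i < m.+1) fz i * (r (m - i).+1 *+ (m - i).+1) =
     c * \sum_(i < m.+1) fz i.+1 *+ i.+1 * r (m - i)%N) ->
  forall n, (n <= N)%N -> specializes_to E`_n (r n)%:~R.
Proof.
move=> sa f0 E0 r0 fz0 fE ode rec; elim/ltn_ind => -[|m] ih mN.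
  by rewrite E0 r0; exact: sp1.
have := ode m mN; have := rec m mN.
rewrite !coefM big_ord_recl [in X in _ -> X -> _]big_ord_recl /= !subn0 fz0 f0 !mul1r.
rewrite coef_deriv => /(canRL (addrK _)) recm /(canRL (addrK _)) odem.
have sx : specializes_to (E`_m.+1 *+ m.+1) ((r m.+1 *+ m.+1)%:~R).
  rewrite odem recm intrB intrM; apply: spD.
    apply: spM => //; rewrite rmorph_sum; apply: sp_sum => i /=.
    rewrite coef_deriv fE ?(leq_trans (ltn_ord i)) // intrM; apply: spM.
      by rewrite -rmorphMn; exact: sp_int.
    by apply: ih; rewrite ?ltnS ?leq_subr // (leq_trans (leq_subr _ _)) // ltnW.
  apply: spN; rewrite rmorph_sum; apply: sp_sum => i /=.
  have im : (bump 0 i <= m)%N by rewrite /bump /= add1n.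
  rewrite (fE _ (leq_trans im (ltnW mN))) intrM; apply: spM; first exact: sp_int.
  rewrite coef_deriv intr_mulrn; apply: spMn; apply: ih.
    by rewrite ltnS subnSK // leq_subr.
  by rewrite (leq_trans _ mN) // ltnS leq_subr.
by apply: (@spMn_inv _ _ m); rewrite -intr_mulrn.
Qed.

Definition conv (l l' : seq nat) : seq nat :=
  [seq sumn [seq nth 0 l j * nth 0 l' (i - j) | j <- iota 0 i.+1] | i <- iota 0 7]%N.

Definition geom (n : nat) : seq nat := [seq (n %| i : nat) | i <- iota 0 7]%N.

Definition convX (l : seq nat) (n : nat) : seq nat :=
  iter n (conv l) [:: 1; 0; 0; 0; 0; 0; 0]%N.

Definition mac : seq nat :=
  foldr (fun n l => conv (convX (geom n) n) l) [:: 1; 0; 0; 0; 0; 0; 0]%N (iota 1 6).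

Definition ncoef (p : {poly K}) (l : seq nat) : Prop :=
  forall i, (i < 7)%N -> p`_i = (nth 0%N l i)%:R.

Lemma ncoefM p q l l' : ncoef p l -> ncoef q l' -> ncoef (p * q) (conv l l').
Proof.
move=> pl ql i i7; rewrite coefM (nth_map 0%N) ?size_iota // nth_iota // add0n.
rewrite sumnE big_map natr_sum -(big_mkord xpredT (fun j => p`_j * q`_(i - j))).
rewrite /index_iota subn0; apply: eq_big_seq => j; rewrite mem_iota add0n ltnS => /andP[_ ji].
by rewrite (pl _ (leq_ltn_trans ji i7)) (ql _ (leq_ltn_trans (leq_subr _ _) i7)) natrM.
Qed.

Lemma ncoef1 : ncoef 1 [:: 1; 0; 0; 0; 0; 0; 0]%N.
Proof. by move=> i; rewrite coef1; do 7 (case: i => // i). Qed.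

Lemma ncoefX p l n : ncoef p l -> ncoef (p ^+ n) (convX l n).
Proof.
move=> pl; elim: n => [|n ih]; first by rewrite expr0; exact: ncoef1.
by rewrite exprS; exact: ncoefM.
Qed.

Lemma ncoef_geom n : (0 < n)%N -> ncoef (\sum_(k < 7) 'X^(n * k)) (geom n).
Proof.
move=> n0 i i7; rewrite coef_sum (nth_map 0%N) ?size_iota // nth_iota // add0n.
under eq_bigr do rewrite coefXn.
case: dvdnP => [[k ik]|nd]; last first.
  by rewrite big1 // => k _; case: eqP => // ik; case: nd; exists (k : nat); rewrite mulnC.
have k7 : (k < 7)%N by rewrite (leq_ltn_trans _ i7) // ik leq_pmulr.
rewrite (bigD1 (Ordinal k7)) //= ik mulnC eqxx big1 ?addr0 // => j jk.
rewrite eqn_pmul2l //; case: eqP => // kj.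
by case/eqP: jk; apply: val_inj.
Qed.

Lemma ncoef_mac : ncoef (macmahon 7) mac.
Proof.
rewrite /macmahon /mac /index_iota subSS subn0; have : all (leq 1) (iota 1 6) by [].
elim: (iota 1 6) => [|n s ih] /=; first by move=> _; rewrite big_nil; exact: ncoef1.
move=> /andP[n0 /ih h]; rewrite big_cons; apply: ncoefM => //.
by apply: ncoefX; exact: ncoef_geom.
Qed.

Lemma coef_compNX (R : comNzRingType) (p : {poly R}) i :
  (p \Po (- 'X))`_i = (-1) ^+ i * p`_i.
Proof.
elim/poly_ind: p i => [|p c ih] i; first by rewrite comp_poly0 !coef0 mulr0.
rewrite comp_poly_MXaddC !coefD mulrN coefN !coefMX !coefC.
case: i => [|i] /=; first by rewrite oppr0 !add0r expr0 mul1r.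
by rewrite !addr0 ih exprS mulN1r mulNr.
Qed.

Definition sgn (i n : nat) : int := if odd i then - n%:Z else n%:Z.

Definition mac6 : seq nat := convX mac 6.

(** The coefficients of $f\,(f^6)'=6f'f^6$ for $f=M(-q)$. *)
Lemma mac6_rec : all (fun m =>
  foldr +%R 0 [seq sgn i (nth 0 mac i)%N * (sgn (m - i).+1 (nth 0 mac6 (m - i).+1)%N
       *+ (m - i).+1) | i <- iota 0 m.+1] ==
  (6 : int) * foldr +%R 0 [seq sgn i.+1 (nth 0 mac i.+1)%N *+ i.+1 *
       sgn (m - i) (nth 0 mac6 (m - i))%N | i <- iota 0 m.+1]) (iota 0 6).
Proof. by vm_cast_no_check (erefl true). Qed.

(** The correction to $-d$ carries the factor $\lambda_4$, which vanishes in the limit. *)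
Lemma exponentE (F : fieldType) (x1 x2 x3 x4 : F) (d : int) :
  x1 != 0 -> x2 != 0 -> x3 != 0 -> x4 != 0 ->
  (0%:~R * x1 + 0%:~R * x2 + 0%:~R * x3 + d%:~R * x4)
    * (- (x1 * x2 * x3) - x1 * x2 * x4 - x1 * x3 * x4 - x2 * x3 * x4)
    / (x1 * x2 * x3 * x4) =
  (- d)%:~R * (1 + x4 * ((x1 * x2 + x1 * x3 + x2 * x3) / (x1 * x2 * x3))).
Proof. by move=> h1 h2 h3 h4; rewrite intrN; field; rewrite h1 h2 h3 h4. Qed.

Lemma lamE : [/\ lam1 = lam_wt (1, 0, 0, 0), lam2 = lam_wt (0, 1, 0, 0),
  lam3 = lam_wt (0, 0, 1, 0) & lam4 = lam_wt (0, 0, 0, 1)].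
Proof.
have h (F : fieldType) (x y z u : F) :
  [/\ x = 1%:~R * x + 0%:~R * y + 0%:~R * z + 0%:~R * u,
     y = 0%:~R * x + 1%:~R * y + 0%:~R * z + 0%:~R * u,
     z = 0%:~R * x + 0%:~R * y + 1%:~R * z + 0%:~R * u &
     u = 0%:~R * x + 0%:~R * y + 0%:~R * z + 1%:~R * u] by split; ring.
exact: h.
Qed.

Lemma sp_exponent d : specializes_to (macmahon_exponent 0 0 0 d) (- d)%:~R.
Proof.
have [e1 e2 e3 e4] := lamE.
rewrite [macmahon_exponent _ _ _ _]exponentE; first last.
- by rewrite e4 lam_eq0.
- by rewrite e3 lam_eq0.
- by rewrite e2 lam_eq0.
- by rewrite e1 lam_eq0.
have s1 : specializes_to lam1 (lam0 (1, 0, 0, 0)) by rewrite e1; exact: sp_lam.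
have s2 : specializes_to lam2 (lam0 (0, 1, 0, 0)) by rewrite e2; exact: sp_lam.
have s3 : specializes_to lam3 (lam0 (0, 0, 1, 0)) by rewrite e3; exact: sp_lam.
have s4 : specializes_to lam4 0 by rewrite /lam4 -[0]oppr0; exact: spN sp_kap.
rewrite -[X in specializes_to _ X]mulr1; apply: spM; first exact: sp_int.
rewrite -[X in specializes_to _ X]addr0; apply: spD; first exact: sp1.
have mul0K (y : K0) : 0 = 0 * y by rewrite mul0r.
rewrite (mul0K ((lam0 (1, 0, 0, 0) * lam0 (0, 1, 0, 0) + lam0 (1, 0, 0, 0) * lam0 (0, 0, 1, 0)
  + lam0 (0, 1, 0, 0) * lam0 (0, 0, 1, 0))
  / (lam0 (1, 0, 0, 0) * lam0 (0, 1, 0, 0) * lam0 (0, 0, 1, 0)))).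
apply: spM => //; apply: spM.
  by apply: spD; [apply: spD|]; exact: spM.
apply: spV; last by apply: spM => //; exact: spM.
by rewrite !mulf_neq0 // lam0_eq0.
Qed.

Lemma sgnE (R : pzRingType) i n : (sgn i n)%:~R = (-1) ^+ i * n%:R :> R.
Proof.
by rewrite /sgn -signr_odd; case: (odd i); rewrite ?mulN1r ?mul1r ?intrN -pmulrn.
Qed.

Lemma sp_macmahon n : (n < 7)%N ->
  specializes_to (macmahon_neg_pow 7 (macmahon_exponent 0 0 0 (- 6)))`_n
    (sgn n (nth 0%N mac6 n))%:~R.
Proof.
move=> n7; rewrite /macmahon_neg_pow coef_take_poly n7.
set f := macmahon 7 \Po - 'X; set a := macmahon_exponent _ _ _ _.
have fE i : (i <= 6)%N -> f`_i = (sgn i (nth 0%N mac i))%:~R.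
  by move=> i6; rewrite coef_compNX ncoef_mac // sgnE.
have f0 : f`_0 = 1 by rewrite fE.
have sa : specializes_to a (6 : int)%:~R by have := sp_exponent (- 6); rewrite opprK.
have E0 : (exp_series 7 (a *: log_series 7 f))`_0 = 1 by exact: exp_log_coef0.
have ode m : (m < 6)%N -> (f * (exp_series 7 (a *: log_series 7 f))^`())`_m =
    a * (f^`() * exp_series 7 (a *: log_series 7 f))`_m.
  by move=> m6; apply: series_ode => //; exact: K_nat_neq0.
refine (@spec_ode (fun i => sgn i (nth 0%N mac i)) (fun i => sgn i (nth 0%N mac6 i))
  6 f _ a 6 sa f0 E0 erefl erefl fE ode _ n n7).
move=> m m6; have /allP/(_ m) := mac6_rec; rewrite mem_iota => /(_ m6) /eqP.
have iotaE (G : nat -> int) k : \sum_(i <- iota 0 k) G i = \sum_(i < k) G i.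
  by rewrite -(big_mkord xpredT) /index_iota subn0.
by rewrite !foldrE !big_map !iotaE.
Qed.

(** * Signs *)

(** Each of the $h$ nonempty plane partitions in a tuple contains the corner once. Choosing which
    $h$ of six places they occupy and leaving the others empty gives all 6-tuples of plane
    partitions of total size $n$, and these are counted by $M(q)^6$. *)
Lemma solids6_count : all (fun n =>
  sumn [seq ntuples s * 'C(6, height s) | s <- solids6 & sumn (map snd s) == n]%N
    == nth 0%N mac6 n) (iota 0 7).
Proof. by vm_cast_no_check (erefl true). Qed.

Lemma solids6_sound s : s \in solids6 ->
  [/\ check s, is_solid (arr s), (psize (arr s) <= 6)%N & wf s].
Proof.
move=> sin; have /andP[/allP/(_ s sin)/and4P[chk sol le _] _] := solids6_check.
have /and5P[ws _ _ _ _] := chk; split; [exact: chk|exact: solidbP sol| |exact: ws].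
by rewrite (psize_arr ws).
Qed.

Lemma arr_solids6_inj : {in solids6 &, injective arr}.
Proof.
have /andP[/allP h _] := solids6_check.
move=> s s' /h/and4P[_ _ _ /eqP sE] /h/and4P[_ _ _ /eqP sE'] e.
rewrite sE sE' /canon; congr filter; apply: eq_map => x.
by rewrite -!arrE e.
Qed.

(* Hiding the list behind an existential keeps unification from computing it. *)
Lemma solids_upto6 : exists S : seq (seq nb), [/\ uniq (map arr S),
  forall s, s \in S -> [/\ check s, is_solid (arr s), (psize (arr s) <= 6)%N & wf s],
  forall pi : array3, is_solid pi -> (psize pi <= 6)%N -> exists2 s, s \in S & pi = arr s
  & forall n, (n < 7)%N ->
      sumn [seq ntuples s * 'C(6, height s) | s <- S & sumn (map snd s) == n]%N
      = nth 0%N mac6 n].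
Proof.
exists solids6; split.
- rewrite (map_inj_in_uniq arr_solids6_inj).
  exact: (andP solids6_check).2.
- exact: solids6_sound.
- exact: solids6P.
- move=> n n7; have /allP/(_ n) := solids6_count; rewrite mem_iota => /(_ n7).
  exact: eqP.
Qed.

Lemma gen_seriesE (S : seq (seq nb)) (w : array3 -> K) (d1 d2 d3 d4 : int) :
  uniq (map arr S) ->
  (forall pi : array3, pi \in map arr S <-> is_solid pi /\ (psize pi < 7)%N) ->
  gen_series 7 w d1 d2 d3 d4 =
  \sum_(s <- S) ((Lpi (arr s) (d1%:~R : K^o) d2%:~R d3%:~R d4%:~R : K)
    * w (arr s)) *: 'X^(psize (arr s)).
Proof.
move=> u SP; rewrite /gen_series.
have -> : [set pi | is_solid pi /\ (psize pi < 7)%N]%classic = [set` map arr S]%classic.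
  by apply/seteqP; split=> pi /SP.
by rewrite -(fsbig_seq _ _ u) big_map.
Qed.

Definition falling6 (h : nat) : rat := \prod_(l < h) (6 - l%:R).

Lemma falling6E h : (h <= 6)%N -> falling6 h = (6 ^_ h)%:R.
Proof.
move=> h6; rewrite ffact_prod natr_prod; apply: eq_bigr => l _.
by rewrite natrB // (leq_trans _ h6) // ltnW.
Qed.

Lemma omega_at6 pi w om : is_omega pi w om ->
  specializes_to ((Lpi pi (0%:~R : K^o) 0%:~R 0%:~R (- 6)%:~R : K) * w)
    (rat_K0 ((-1) ^+ psize pi * om * falling6 (pi (0, 0, 0)%N))).
Proof.
move=> h; have sp : pspec (w *: \prod_(b <- boxes pi) Lfac b)
    (map_poly rat_K0 (((-1) ^+ psize pi * om) *: \prod_(l < pi (0, 0, 0)%N) ('X - l%:R%:P))).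
  by move=> n; rewrite coef_map -LpiE; exact: h.
have := pspec_horner sp (sp_rat 6); rewrite hornerZ -Lpi_scalarE mulrC.
rewrite horner_map hornerZ horner_prod.
have -> : \prod_(l < pi (0, 0, 0)%N) ('X - (l%:R)%:P).[6] = falling6 (pi (0, 0, 0)%N) :> rat.
  by apply: eq_bigr => l _; rewrite hornerD hornerN hornerX hornerC.
have -> : (- 6)%:~R = - rat_K 6 :> K^o by rewrite rmorph_nat mulrNz.
by [].
Qed.

Lemma omega_signs (w : array3 -> K) :
  (forall pi : array3, is_solid pi -> (psize pi <= 6)%N -> is_wpi pi (w pi)) ->
  (forall d1 d2 d3 d4 : int, gen_series 7 w d1 d2 d3 d4
     = macmahon_neg_pow 7 (macmahon_exponent d1 d2 d3 d4)) ->
  forall pi : array3, is_solid pi -> (psize pi <= 6)%N ->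
  exists2 om : rat, is_omega pi (w pi) om & om = omega_c pi.
Proof.
move=> hw hg; have [S [u S_sound SP S_count]] := solids_upto6.
have memS (pi : array3) : pi \in map arr S <-> is_solid pi /\ (psize pi < 7)%N.
  split=> [/mapP[s sin ->]|[sol le]]; first by have [_ sol le _] := S_sound s sin.
  by have [s sin ->] := SP pi sol le; exact: map_f.
have /boolp.choice[om omP] s : exists om, s \in S ->
    is_omega (arr s) (w (arr s)) om /\ `|om| = omega_c (arr s).
  have [sin|nin] := boolP (s \in S); last by exists 0.
  have [chk sol le _] := S_sound _ sin.
  have [o h e] := check_omega chk (hw _ sol le).
  exists o => _; exact: conj h e.
have weight s : s \in S ->
    0 < falling6 (height s) /\
    omega_c (arr s) * falling6 (height s) = (ntuples s * 'C(6, height s))%:R.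
  move=> sin; have [chk _ le ws] := S_sound _ sin.
  have h6 : (height s <= 6)%N.
    apply: leq_trans le; rewrite (psize_arr ws) /height.
    by case: (map snd s) => //= v l; rewrite leq_addr.
  rewrite falling6E //; split; first by rewrite ltr0n ffact_gt0.
  case/and5P: chk => _ /eqP hd _ _ _; rewrite (omega_cE ws hd) -/(ntuples s) -/(height s).
  by rewrite -bin_ffact !natrM mulrA mulrAC mulfVK // pnatr_eq0 -lt0n fact_gt0.
move=> pi sol le; have [s sin piE] := SP pi sol le.
have [oms ome] := omP s sin; exists (om s); rewrite piE //.
have height0 t : t \in S -> arr t (0, 0, 0)%N = height t.
  move=> /S_sound[/and5P[_ /eqP hd _ _ _] _ _ _]; rewrite arrE.
  by case: t hd => [|[x v] t] //= ->; rewrite eqxx.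
pose n := psize pi.
have n7 : (n < 7)%N by [].
(* The identity at $(0,0,0,-6)$ is compared in degree $n$. The sign $(-1)^n$ occurs in the
   definition of $\omega$ as well as in $M(-q)$ and drops out. *)
have sum_om : \sum_(t <- S | psize (arr t) == n) om t * falling6 (height t) =
    (nth 0%N mac6 n)%:R.
  have := sp_macmahon n7; rewrite -hg (gen_seriesE _ _ _ _ _ u memS) coef_sum => sp.
  have sp' : specializes_to
      (\sum_(t <- S) (((Lpi (arr t) (0%:~R : K^o) 0%:~R 0%:~R (- 6)%:~R : K)
         * w (arr t)) *: 'X^(psize (arr t)))`_n)
      (rat_K0 (\sum_(t <- S | psize (arr t) == n)
                 (-1) ^+ n * (om t * falling6 (height t)))).
    rewrite rmorph_sum [X in specializes_to _ X]big_mkcond /= big_seq.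
    rewrite [X in specializes_to _ X]big_seq; apply: (big_ind2 specializes_to) => [||t tin].
    - exact: sp0.
    - by move=> *; exact: spD.
    rewrite coefZ coefXn eq_sym; case: eqP => [tn|_]; last by rewrite mulr0; exact: sp0.
    rewrite mulr1 mulrA -tn -height0 //; apply: omega_at6.
    by case: (omP t tin).
  have := specializes_to_inj sp sp'; rewrite -(rmorph_int rat_K0) => /rat_K0_inj.
  by rewrite sgnE -mulr_sumr => /(mulrI (unitrX _ (unitrN1 _))).
(* Since $\omega\leqslant|\omega|=\omega^c$, this is a vanishing sum of nonnegative terms, so each
   term is zero. *)
have /eqP : \sum_(t <- S | psize (arr t) == n)
    (omega_c (arr t) - om t) * falling6 (height t) = 0.
  under eq_bigr do rewrite mulrBl.
  rewrite sumrB sum_om; apply/eqP; rewrite subr_eq0; apply/eqP.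
  rewrite -(S_count n n7).
  rewrite sumnE big_map big_filter natr_sum big_seq_cond [RHS]big_seq_cond.
  apply: eq_big => [t|t /andP[tin _]]; last by case: (weight t tin).
  case tin: (t \in S) => //=.
  by have [_ _ _ wt] := S_sound _ tin; rewrite psize_arr.
rewrite big_seq_cond psumr_eq0 => [/allP/(_ s sin)|t /andP[tin _]]; last first.
  have [pos _] := weight t tin; have [_ e] := omP t tin.
  by rewrite mulr_ge0 ?(ltW pos) // subr_ge0 -e ler_norm.
rewrite sin /n piE eqxx /= mulf_eq0 subr_eq0.
have [pos _] := weight s sin; rewrite (gt_eqF pos) orbF => /eqP.
by [].
Qed.

Theorem proposition4p14 :
  (forall w : array3 -> K,
     (forall pi : array3, is_solid pi -> (psize pi <= 6)%N ->
        is_wpi pi (w pi)) ->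
     (forall d1 d2 d3 d4 : int,
        gen_series 7 w d1 d2 d3 d4
        = macmahon_neg_pow 7 (macmahon_exponent d1 d2 d3 d4)) ->
     forall pi : array3, is_solid pi -> (psize pi <= 6)%N ->
       exists2 om : rat, is_omega pi (w pi) om & om = omega_c pi)
  /\
  (forall (pi : array3) (w : K),
     is_solid pi -> pi (0, 0, 0)%N = 1%N -> is_wpi pi w ->
     exists2 om : rat, is_omega_at 1 pi w om & `|om| = omega_c pi)
  /\
  (forall (pi : array3) (w : K),
     is_solid pi ->
     (forall i j k : nat, pi (i, j, k) <> 0%N -> i = 0%N /\ j = 0%N) ->
     (psize pi <= 10)%N -> is_wpi pi w ->
     exists2 om : rat, is_omega pi w om
       & `|om| = omega_c pi /\
         omega_c pi
         = \big[*%R/1]_(k \in [set: nat])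
             ((((pi (0, 0, k) - pi (0, 0, k.+1))`!)%N%:R)^-1 : rat))
  /\
  (forall (Z : laurent) (v : rat),
     (Z, v) \in
       [:: (1 + t1 + t2 + t1 * t2 + t3 + t4 + t4 ^+ 2, 3 / 2);
           (1 + t1 + t2 + t1 * t2 + t3 + t4 + t1 * t4 + t4 ^+ 2, 3);
           (1 + t1 + t1 ^+ 2 + t2 + t1 * t2 + t3 + t4 + t1 * t4 + t4 ^+ 2, 6);
           (1 + t1 + t1 ^+ 2 + t2 + t1 * t2 + t2 * t3 + t3 + t4 + t1 * t4
            + t4 ^+ 2, 2);
           (1 + t1 + t1 ^+ 2 + t2 + t1 * t2 + t2 * t3 + t3 + t4 + t1 * t4
            + t2 * t4 + t4 ^+ 2, 8);
           (1 + t1 + t1 ^+ 2 + t2 + t1 * t2 + t2 * t3 + t3 + t4 + t1 * t4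
            + t2 * t4 + t4 ^+ 2 + t4 ^+ 3, 6);
           (1 + t1 + t1 ^+ 2 + t2 + t1 * t2 + t2 * t3 + t3 + t4 + t1 * t4
            + t2 * t4 + t4 ^+ 2 + t4 ^+ 3 + t4 ^+ 4, 8 / 3);
           (1 + t1 + t1 ^+ 2 + t2 + t1 * t2 + t2 * t3 + t3 + t4 + t1 * t4
            + t2 * t4 + t4 ^+ 2 + t4 ^+ 3 + t4 ^+ 4 + t4 ^+ 5, 5 / 6);
           (1 + t1 + t1 ^+ 2 + t2 + t2 ^+ 2 + t1 * t2 + t2 * t3 + t3 + t4
            + t1 * t4 + t2 * t4 + t4 ^+ 2 + t4 ^+ 3 + t4 ^+ 4 + t4 ^+ 5,
            5 / 3)] ->
     forall (pi : array3) (w : K),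
       is_solid pi -> Zpi pi = Z -> is_wpi pi w ->
       exists2 om : rat, is_omega pi w om & `|om| = omega_c pi /\ omega_c pi = v).
Proof.
split; first exact: omega_signs.
split; first by move=> pi w sol pi0 wpi; exact: omega_plane.
split; first exact: omega_column.
exact: omega_table.
Qed.
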